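(* Assume the standing assumptions (S) and let $$M^{(N)}:=\frac{1}{\sqrt N}\Big(\alpha\big(\tfrac{|i-j|}{N}\big)X^{(N)}_{ij}\Big)_{1\le i,j\le N}.$$ Then for every $k\in\mathbb N$ the limit $\mu_k:=\lim_{N\to\infty}\frac1N\,\mathbb E\big(\operatorname{tr}(M^{(N)})^k\big)$ exists and $$\mu_k=\begin{cases}\sum_{\pi\in\mathcal B_{k/2}}J_\alpha(\pi)&k\text{ even},\\ 0&k\text{ odd.}\end{cases}$$
   Context: Standing assumptions (S): $\alpha:[0,1]\to\mathbb R$ is bounded and Riemann-integrable. For each $N\in\mathbb N$, $(X^{(N)}_{ij})_{1\le i,j\le N}$ are real random variables on a common probability space with $X^{(N)}_{ij}=X^{(N)}_{ji}$, $\mathbb E X^{(N)}_{ij}=0$, $\mathbb E (X^{(N)}_{ij})^2=1$, and $\sup_N\max_{i,j}\mathbb E|X^{(N)}_{ij}|^k\le R_k<\infty$ for every $k\ge 1$. For each $N$, $\sim$ is an equivalence relation on $\{1,\dots,N\}^2$ with $(p,q)\sim(q,p)$ for all $p,q$, satisfying, as $N\to\infty$: (C1) $\max_p\#\{(q,r,s)\in\{1,\dots,N\}^3:(p,q)\sim(r,s)\}=o(N^2)$; (C2) $\max_{p,q,r}\#\{s\in\{1,\dots,N\}:(p,q)\sim(r,s)\}\le B<\infty$ with $B$ independent of $N$; (C3) $\#\{(p,q,r)\in\{1,\dots,N\}^3:(p,q)\sim(q,r),\ r\neq p\}=o(N^2)$. Entries indexed by non-equivalent pairs are independent: for each $N$,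 the families $\{X^{(N)}_{pq}:(p,q)\in C\}$, $C$ ranging over the distinct $\sim$-equivalence classes, are mutually independent. $\mathcal B_{k/2}$ ($k$ even) is the set of non-crossing pair-partitions of $\{1,\dots,k\}$ (partitions into 2-element blocks with no $1\le a<b<c<d\le k$ such that $\{a,c\},\{b,d\}$ are both blocks). The integral $J_\alpha$: for $\pi\in\mathcal B_{k/2}$, let $G(\pi)=(G_1,\dots,G_k)$ be a $\pi$-adopted sequence in a countably infinite set $\mathcal G$ (it exists, is unique up to a bijection of $\mathcal G$, and has exactly $k/2+1$ distinct entries); let $V_\pi=\{G_1,\dots,G_k\}$ and $\mathcal K_\pi=\{\{G_j,G_{j+1}\}:1\le j\le k\}$ with $G_{k+1}:=G_1$ (a set of $2$-element subsets of $V_\pi$). Then $$J_\alpha(\pi):=\int_{[0,1]^{V_\pi}}\prod_{\{u,v\}\in\mathcal K_\pi}\alpha^2(|x_u-x_v|)\,dx .$$ Here $\pi$-adopted is defined recursively in $k$: for $k=2$, $(g_1,g_2)$ is $\{\{1,2\}\}$-adopted iff $g_1\ne g_2$; for $k\ge4$, $g$ is $\pi$-adopted iff for every block $\{m,m+1\}\in\pi$ with $1\le m\le k-2$: $g_m=g_{m+2}$, $g_{m+1}\neq g_s$ for all $s\neq m+1$, and $(g_1,\dots,g_m,g_{m+3},\dots,g_k)$ is adopted for the partition of $\{1,\dots,k-2\}$ obtained from $\pi$ by deleting $\{m,m+1\}$ and relabelling each remaining $a>m$ as $a-2$. *)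

(* Defs.v *)
From HB Require Import structures.
From mathcomp Require Import all_boot all_order all_algebra.
From mathcomp Require Import all_classical all_reals all_analysis.
From Stdlib Require Import ClassicalEpsilon.
Set Implicit Arguments. Unset Strict Implicit. Unset Printing Implicit Defensive.
Import Order.TTheory GRing.Theory Num.Theory.
Import numFieldNormedType.Exports.
Local Open Scope classical_set_scope.
Local Open Scope ring_scope.

Section Defs.
Variable R : realType.

Definition riemann_integrable01 (f : R -> R) : Prop :=
  exists I : R, forall eps : R, 0 < eps -> exists2 delta : R, 0 < delta &
    forall (n : nat) (t xi : nat -> R),
      t 0%N = 0 -> t n = 1 ->
      (forall i, (i < n)%N ->
         [/\ t i <= t i.+1, t i.+1 - t i < delta & t i <= xi i <= t i.+1]) ->
      `| \sum_(i < n) f (xi i) * (t i.+1 - t i) - I | < eps.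

Fixpoint cube_int (n : nat) (f : seq R -> \bar R) : \bar R :=
  match n with
  | 0%N => f [::]
  | n'.+1 => (\int[@lebesgue_measure R]_(t in `[0%R, 1%R]%classic)
                cube_int n' (fun xs => f (t :: xs)))%E
  end.
End Defs.

(* Pair partitions of {0,..,k-1} encoded by the partner map p. *)
Definition is_ncpp (k : nat) (p : {ffun 'I_k -> 'I_k}) : bool :=
  [forall i, (p i != i) && (p (p i) == i)] &&
  ~~ [exists a : 'I_k, exists b : 'I_k, (a < b)%N && (b < p a)%N && (p a < p b)%N].

Definition ppseq (k : nat) (p : {ffun 'I_k -> 'I_k}) : seq nat :=
  [seq nat_of_ord (p i) | i <- enum 'I_k].

Definition del_block (m : nat) (s : seq nat) : seq nat :=
  [seq (if (m.+1 < a)%N then a - 2 else a)%N | a <- take m s ++ drop m.+2 s].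

Fixpoint adoptedF (fuel : nat) (s g : seq nat) : Prop :=
  match fuel with
  | 0%N => False
  | fuel'.+1 =>
    if size s == 2%N then nth 0%N g 0 <> nth 0%N g 1
    else forall m, (m.+2 < size s)%N -> nth 0%N s m = m.+1 ->
      [/\ nth 0%N g m = nth 0%N g m.+2,
          (forall t, (t < size s)%N -> t <> m.+1 -> nth 0%N g m.+1 <> nth 0%N g t)
        & adoptedF fuel' (del_block m s) (take m.+1 g ++ drop m.+3 g)]
  end.

Definition adopted (s g : seq nat) : Prop :=
  size g = size s /\ adoptedF (size s) s g.

Definition Gseq (s : seq nat) : seq nat :=
  epsilon (inhabits [::]) (fun g => adopted s g).

(* edge set K_pi as unordered pairs (min, max), cyclic *)
Definition edges (g : seq nat) : seq (nat * nat) :=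
  undup [seq (minn (nth 0%N g j) (nth 0%N g (j.+1 %% size g)),
              maxn (nth 0%N g j) (nth 0%N g (j.+1 %% size g))) | j <- iota 0 (size g)].

Definition Jalpha (R : realType) (alpha : R -> R) (s : seq nat) : R :=
  let g := Gseq s in
  let V := undup g in
  let coord (x : seq R) (u : nat) := nth 0 x (index u V) in
  fine (cube_int (size V) (fun x =>
    (\prod_(e <- edges g) (alpha `|coord x e.1 - coord x e.2|) ^+ 2)%:E)).

Section RM.
Context (R : realType) (d : measure_display) (T : measurableType d)
        (P : probability T R).

Definition Mmat (alpha : R -> R) (N : nat) (X : 'I_N -> 'I_N -> {RV P >-> R})
  (w : T) : 'M[R]_N :=
  \matrix_(i, j) ((Num.sqrt (N%:R))^-1 * alpha (`|(i%:R : R) - j%:R| / N%:R)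
                   * X i j w).

Definition moment (alpha : R -> R) (X : forall N : nat, 'I_N -> 'I_N -> {RV P >-> R})
  (k N : nat) : R :=
  (N%:R)^-1 * fine ('E_P[fun w => \tr (Mmat alpha (X N) w ^+ k)])%E.

(* the families indexed by distinct equivalence classes are mutually
   independent (product rule on the generating cylinder events) *)
Definition indep_classes (N : nat) (X : 'I_N -> 'I_N -> {RV P >-> R})
  (eqv : rel ('I_N * 'I_N)) : Prop :=
  forall B : 'I_N * 'I_N -> set R, (forall p, measurable (B p)) ->
    P (\bigcap_(p in [set: 'I_N * 'I_N]) (X p.1 p.2 @^-1` B p)) =
    (\prod_(C in [set [set q | eqv p q] | p : 'I_N * 'I_N]%SET)
       P (\bigcap_(p in [set p | p \in C]) (X p.1 p.2 @^-1` B p)))%E.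
End RM.

(* Main.v *)
Require Import Defs.
From HB Require Import structures.
From mathcomp Require Import all_boot all_order all_algebra.
From mathcomp Require Import all_classical all_reals all_analysis.
From mathcomp Require Import measurable_realfun.
From mathcomp Require Import zify ring lra.
Set Implicit Arguments. Unset Strict Implicit. Unset Printing Implicit Defensive.

(** Expand the trace over closed walks [i_1, ..., i_k] in [{1..N}] with edges
    [e_j = (i_j, i_(j+1))]. By independence a walk contributes only if every edge is
    equivalent to another one, and walking along the tuple, (C2) leaves a bounded choice
    whenever an edge is equivalent to an earlier one; so tuples with fewer than [k/2] classes
    are negligible and the edge classes may be assumed to form a pairing. If the pairing has
    two adjacent partners, then either [i_m <> i_(m+2)], which is rare by (C3), or the two
    edges can be deleted; if it has none, a block of minimal length is rare by (C1). Deletion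
    thus shows that, up to [o(N^(k/2+1))] tuples, the pairing is noncrossing and the walk
    folds onto a tree with [k/2] edges, each traversed once in either direction. These walks
    have expectation one, and their weights form a Riemann sum for [J_alpha]. The iterated
    integral is sandwiched between the lower and upper sums on the same grid [1/N], so no
    measurability of [alpha] is needed. *)

(** * Noncrossing pairings and folded walks *)

(** Adoptedness is recursive and quantifies over every adjacent block, so neither the existence of
    an adopted sequence nor independence of the order of deletion is visible from it. It is replaced
    by an order-free description: an adopted sequence is a folded walk with the largest possible
    number [k/2 + 1] of distinct vertices. The same maximality turns any folded tuple into a
    labelling of the vertices of [Gseq]. In [Jalpha] the product runs over edges without repetition,
    while a folded walk yields one squared weight per block; the two agree because reaching
    [k/2 + 1] vertices takes at least [k/2] proper edges, so the block edges are distinct and none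
    is a loop. The normalisation is [N^(-1-k/2)]. Too few classes then cost a factor [N^(-1/2)], and
    the other exceptional tuples leave [(c1 + c3) / N^2], with [c1] and [c3] the counts of (C1) and
    (C3). Independence is given for events only and has to be carried over to moments of unbounded
    entries. *)

Definition pairing (s : seq nat) : Prop := forall j, j < size s ->
  [/\ nth 0 s j < size s, nth 0 s j <> j & nth 0 s (nth 0 s j) = j].

Definition noncrossing (s : seq nat) : Prop := forall a b,
  a < size s -> b < size s -> a < b -> b < nth 0 s a -> nth 0 s a < nth 0 s b -> False.

(* [skip m] enumerates the positions other than [m] and [m.+1]; [close m] is its inverse. *)
Definition skip m j := if j < m then j else j.+2.
Definition close m a := if m.+1 < a then a - 2 else a.

Lemma skipK m : cancel (skip m) (close m).
Proof. by move=> j; rewrite /skip /close; case: (ltnP j m) => H; case: ifP; lia. Qed.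

Lemma closeK m a : a <> m -> a <> m.+1 -> skip m (close m a) = a.
Proof. by move=> *; rewrite /skip /close; case: (ltnP m.+1 a) => H; case: ifP; lia. Qed.

Lemma skip_neq m j : skip m j <> m /\ skip m j <> m.+1.
Proof. by rewrite /skip; case: ifP; lia. Qed.

Lemma size_del_block m s : m.+1 < size s -> size (del_block m s) = size s - 2.
Proof. by move=> H; rewrite size_map size_cat size_drop size_takel; lia. Qed.

Lemma nth_del_block m s j : m.+1 < size s -> j < size s - 2 ->
  nth 0 (del_block m s) j = close m (nth 0 s (skip m j)).
Proof.
move=> H Hj; rewrite (nth_map 0); last by rewrite size_cat size_drop size_takel; lia.
rewrite nth_cat size_takel; last lia.
rewrite /skip; case: (ltnP j m) => Hm; first by rewrite nth_take.
by rewrite nth_drop (_ : m.+2 + (j - m) = j.+2) //; lia.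
Qed.

Section Deletion.
Variables (m : nat) (s : seq nat).
Hypothesis ms : m.+2 < size s.

Lemma skip_lt j : j < size s - 2 -> skip m j < size s.
Proof. by rewrite /skip; case: ifP; lia. Qed.

Lemma close_lt a : a < size s -> a <> m.+1 -> close m a < size s - 2.
Proof. rewrite /close; case: ifP; lia. Qed.

Hypotheses (sP : pairing s) (sm : nth 0 s m = m.+1).

Lemma partner_adj : nth 0 s m.+1 = m.
Proof. by have [_ _] := sP (ltac:(lia) : m < size s); rewrite sm. Qed.

Lemma partner_neq a : a < size s -> a <> m -> a <> m.+1 ->
  nth 0 s a <> m /\ nth 0 s a <> m.+1.
Proof.
move=> ha h1 h2; have [_ _ hK] := sP ha.
by split=> h; move: hK; rewrite h ?sm ?partner_adj; lia.
Qed.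

Lemma skip_partner j : j < size s - 2 ->
  skip m (nth 0 (del_block m s) j) = nth 0 s (skip m j).
Proof.
move=> hj; have [h1 h2] := skip_neq m j.
have [h3 h4] := partner_neq (skip_lt hj) h1 h2.
by rewrite nth_del_block ?closeK //; lia.
Qed.

Lemma pairing_del : pairing (del_block m s).
Proof.
move=> j; rewrite size_del_block; last lia.
move=> hj; have [h1 h2 h3] := sP (skip_lt hj).
have hlt : nth 0 (del_block m s) j < size s - 2.
  have [? ?] := skip_neq m j; rewrite nth_del_block ?close_lt //; try lia.
  by case: (@partner_neq (skip m j)) => //; apply: skip_lt.
split=> //.
- by move=> e; apply: h2; rewrite -skip_partner // e.
- by apply: (can_inj (skipK m)); rewrite skip_partner // skip_partner.
Qed.

Lemma skip_mono : {mono skip m : a b / a < b}.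
Proof. by move=> a b; rewrite /skip; case: ifP; case: ifP; lia. Qed.

(** A crossing cannot involve the block {m, m+1}, because no position fits strictly between its
    ends. Every other crossing is transported by the monotone [skip]. *)
Lemma noncrossing_del : noncrossing (del_block m s) <-> noncrossing s.
Proof.
split=> nc a b; last first.
  rewrite size_del_block; last lia.
  move=> ha hb h1 h2 h3.
  by apply: (nc (skip m a) (skip m b));
    rewrite ?skip_lt // -?skip_partner // skip_mono.
move=> ha hb hab hbs hss.
have pm := partner_adj.
have [am|am] := eqVneq a m; first by move: hbs hab; rewrite am sm; lia.
have [am1|am1] := eqVneq a m.+1; first by move: hbs hab; rewrite am1 pm; lia.
have [bm|bm] := eqVneq b m.
  by move: hss hbs; rewrite bm sm; lia.
have [bm1|bm1] := eqVneq b m.+1.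
  by move: hss hbs; rewrite bm1 pm; lia.
have Sa : skip m (close m a) = a by apply: closeK; lia.
have Sb : skip m (close m b) = b by apply: closeK; lia.
have ca := close_lt ha (elimN eqP am1); have cb := close_lt hb (elimN eqP bm1).
apply: (nc (close m a) (close m b)); rewrite ?size_del_block //; try lia.
- by rewrite -skip_mono Sa Sb.
- by rewrite -skip_mono skip_partner // Sa Sb.
- by rewrite -skip_mono !skip_partner // Sa Sb.
Qed.

End Deletion.

(** If [a] is not matched with its successor, noncrossing places the partner of [a.+1] strictly
    between [a.+1] and the partner of [a]. Passing to this nested block shortens the length, so the
    descent ends at an adjacent block. *)
Lemma adj_block_inside s a : pairing s -> noncrossing s ->
  a < size s -> a < nth 0 s a ->
  exists m, [/\ a <= m, m < nth 0 s a & nth 0 s m = m.+1].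
Proof.
move=> sP nc; move: {2}(nth 0 s a - a) (leqnn (nth 0 s a - a)) => n.
elim: n a => [|n IH] a hn ha hlt; first lia.
have [e|ne] := eqVneq (nth 0 s a) a.+1; first by exists a; rewrite e.
have [h1 h2 h3] := sP _ ha.
have hb : a.+1 < size s by lia.
have [k1 k2 k3] := sP _ hb.
have ltb : nth 0 s a.+1 < nth 0 s a.
  have [//|/(nc a a.+1)|e] := ltngtP (nth 0 s a.+1) (nth 0 s a); 
    first by move=> H; exfalso; apply: H => //; lia.
  by move: h3; rewrite -e k3; lia.
have gta : a.+1 < nth 0 s a.+1.
  have : nth 0 s a.+1 <> a by move=> e; move: k3; rewrite e; lia.
  have : nth 0 s a.+1 < a -> False; last lia.
  move=> lta; have [l1 l2 l3] := sP _ k1.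
  by apply: (nc (nth 0 s a.+1) a); rewrite ?k3 //; lia.
have [m [m1 m2 m3]] := IH a.+1 ltac:(lia) hb gta.
by exists m; split => //; lia.
Qed.

(** The strict bound [m.+2 < size s] is the restriction built into adoptedness, which ignores a
    block formed by the last two positions. If 0 is matched with the last position, the search
    starts at 1, whose block is then strictly inside. *)
Lemma exists_adj_block s : pairing s -> noncrossing s -> 2 < size s ->
  exists2 m, m.+2 < size s & nth 0 s m = m.+1.
Proof.
move=> sP nc hs.
have [h1 h2 h3] := sP 0 ltac:(lia).
have [hlt|hge] := ltnP (nth 0 s 0).+1 (size s).
  have [m [m1 m2 m3]] := adj_block_inside sP nc (ltac:(lia) : 0 < size s) ltac:(lia).
  by exists m => //; lia.
have [k1 k2 k3] := sP 1 ltac:(lia).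
have n0 : nth 0 s 1 <> 0 by move=> e; move: k3; rewrite e; lia.
have nl : nth 0 s 1 <> nth 0 s 0 by move=> e; move: k3; rewrite e h3.
have [m [m1 m2 m3]] := adj_block_inside sP nc (ltac:(lia) : 1 < size s) ltac:(lia).
by exists m => //; lia.
Qed.

Lemma card_involution_lt k (p : 'I_k -> 'I_k) : involutive p ->
  (forall j, p j != j) -> #|[pred j : 'I_k | j < p j]|.*2 = k.
Proof.
move=> pK pn.
rewrite -addnn -[X in X + _](fintype.card_image (inv_inj pK)).
rewrite -[RHS](card_ord k) -(cardC [pred j : 'I_k | j < p j]) addnC; congr addn.
apply: eq_card => j; rewrite !inE.
apply/fintype.imageP/idP => [[x]|H].
  by rewrite inE => H ->; rewrite pK -leqNgt ltnW.
exists (p j); rewrite ?pK // inE pK.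
by move: (pn j); rewrite -(inj_eq val_inj) /=; move: H => /=; lia.
Qed.

Section PartnerFunction.
Variables (s : seq nat) (sP : pairing s).

Definition partner (j : 'I_(size s)) : 'I_(size s) :=
  Ordinal (let: And3 h _ _ := sP (ltn_ord j) in h).

Lemma partnerK : involutive partner.
Proof. by move=> j; apply: val_inj => /=; case: (sP (ltn_ord j)). Qed.

Lemma partner_neq_id j : partner j != j.
Proof. by apply/eqP => /(congr1 val) /=; case: (sP (ltn_ord j)). Qed.

Lemma pairing_even : ~~ odd (size s).
Proof. by rewrite -(card_involution_lt partnerK partner_neq_id) odd_double. Qed.

End PartnerFunction.

Lemma size_undup_cons_notin (T : eqType) (x : T) (u v : seq T) :
  u =i x :: v -> size (undup u) = (x \notin v) + size (undup v).
Proof.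
move=> uv; have -> : size (undup u) = size (undup (x :: v)).
  by apply/perm_size/uniq_perm; rewrite ?undup_uniq // => y; rewrite !mem_undup.
by rewrite /=; case: (x \in v).
Qed.

(** * Closed walks folded by a pairing *)

Section Walks.
Variables (T : eqType) (x0 : T).
Implicit Types (g : seq T) (s : seq nat).

Definition edge g j := (nth x0 g j, nth x0 g (j.+1 %% size g)).

(* The two edges of each block are traversed in opposite directions: applied to [j] and to
   its partner, the condition says that one edge is the reversal of the other. *)
Definition folds s g := forall j, j < size s ->
  (edge g j).1 = (edge g (nth 0 s j)).2.

Definition del_vertex m g := take m.+1 g ++ drop m.+3 g.

Lemma size_del_vertex m g : m.+2 < size g -> size (del_vertex m g) = size g - 2.
Proof. by move=> H; rewrite size_cat size_drop size_takel; lia. Qed.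

Lemma nth_del_vertex m g j : m.+2 < size g ->
  nth x0 (del_vertex m g) j = nth x0 g (skip m.+1 j).
Proof.
move=> H; rewrite nth_cat size_takel; last lia.
rewrite /skip; case: (ltnP j m.+1) => Hm; first by rewrite nth_take.
by rewrite nth_drop (_ : m.+3 + (j - m.+1) = j.+2) //; lia.
Qed.

Section DeleteVertex.
Variables (m : nat) (g : seq T).
Hypotheses (mg : m.+2 < size g) (gm : nth x0 g m = nth x0 g m.+2).

(** The vertices lose positions m+1 and m+2, but the edges lose positions m and m+1, hence the two
    different skips. At [j = m] the new edge leaves from [g_m] where the old one left from
    [g_(m+2)]. *)
Lemma edge_del j : j < size g - 2 -> edge (del_vertex m g) j = edge g (skip m j).
Proof.
move=> hj; rewrite /edge !nth_del_vertex // size_del_vertex //; congr pair.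
  rewrite /skip; have [->|ne] := eqVneq j m; first by rewrite ltnS leqnn ltnn.
  by congr (nth x0 g _); case: ifP; case: ifP; lia.
have [e|ne] := eqVneq j.+1 (size g - 2).
  rewrite -e modnn (_ : skip m j = j.+2) /skip; last by case: ifP; lia.
  by rewrite (_ : j.+3 = size g) ?modnn //; lia.
rewrite modn_small; last lia.
rewrite modn_small; last by rewrite /skip; case: ifP; lia.
by congr (nth x0 g _); rewrite /skip; case: ifP; case: ifP; lia.
Qed.

(** The vertex at m+2 survives as its copy at m, so at most the vertex at m+1 disappears. *)
Lemma mem_del_vertex : g =i nth x0 g m.+1 :: del_vertex m g.
Proof.
move=> y; rewrite inE; apply/idP/idP.
  move=> /(nthP x0) [t ht <-]; have [->|ne] := eqVneq t m.+1; first by rewrite eqxx.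
  apply/orP; right.
  have [->|ne2] := eqVneq t m.+2.
    rewrite -gm; apply/(nthP x0); exists m; first by rewrite size_del_vertex; lia.
    by rewrite nth_del_vertex // /skip ltnSn.
  apply/(nthP x0); exists (close m.+1 t).
    by rewrite size_del_vertex // /close; case: ifP; lia.
  by rewrite nth_del_vertex // closeK //; lia.
case/predU1P => [->|]; first by rewrite mem_nth //; lia.
by rewrite mem_cat => /orP [/mem_take|/mem_drop].
Qed.

End DeleteVertex.

(** At the block {m, m+1} folding says only that the walk returns, [g_m = g_(m+2)]. All other
    conditions concern edges that survive the deletion unchanged. *)
Lemma folds_del m s g : m.+2 < size s -> pairing s -> nth 0 s m = m.+1 ->
  size g = size s ->
  folds s g <-> nth x0 g m = nth x0 g m.+2 /\ folds (del_block m s) (del_vertex m g).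
Proof.
move=> ms sP sm sg.
have pm := partner_adj ms sP sm.
have dP := pairing_del ms sP sm.
have sd : size (del_block m s) = size s - 2 by rewrite size_del_block //; lia.
split=> [gf|[gm gf] j hj].
  have gm : nth x0 g m = nth x0 g m.+2.
    have := gf m ltac:(lia); rewrite sm /edge /= => ->.
    by rewrite modn_small ?sg.
  split=> // j; rewrite sd => hj.
  have [h1 _ _] := dP j ltac:(lia).
  rewrite !edge_del ?sg //; last by rewrite -sd.
  by rewrite skip_partner //; apply: gf; apply: skip_lt.
have [->|jm] := eqVneq j m; first by rewrite sm /edge /= modn_small ?sg.
have [->|jm1] := eqVneq j m.+1.
  by rewrite pm /edge /= modn_small ?sg //; lia.
have hc := close_lt ms hj ltac:(lia).
have jE : skip m (close m j) = j by rewrite closeK //; lia.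
have [h1 _ _] := dP (close m j) ltac:(lia).
have := gf (close m j); rewrite sd => /(_ hc).
rewrite !edge_del ?sg //; last by rewrite -sd.
by rewrite skip_partner // jE.
Qed.

(** A deletion removes two positions and at most one vertex, and a walk of length two has at most
    two vertices. *)
Lemma folds_size_undup s g : pairing s -> noncrossing s -> 1 < size s ->
  size g = size s -> folds s g -> size (undup g) <= (size s)./2.+1.
Proof.
have [n] := ubnP (size s); elim: n s g => // n IH s g hn sP nc s2 sg gf.
have [le2|gt2] := leqP (size s) 2.
  by have := size_undup g; rewrite sg (_ : size s = 2) //; lia.
have [m ms sm] := exists_adj_block sP nc gt2.
have ev := pairing_even sP.
have [gm gf'] := (folds_del ms sP sm sg).1 gf.
have sd : size (del_block m s) = size s - 2 by rewrite size_del_block //; lia.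
have := IH (del_block m s) (del_vertex m g); rewrite sd size_del_vertex ?sg //.
move=> /(_ _ (pairing_del ms sP sm) ((noncrossing_del ms sP sm).2 nc) _ erefl gf').
move=> /(_ ltac:(lia) ltac:(lia)).
rewrite (size_undup_cons_notin (mem_del_vertex _ gm)) ?sg //.
by case: (_ \notin _) => /=; lia.
Qed.

(** The order-free form of adoptedness: equality in the bound on the number of vertices. *)
Definition treelike s g :=
  [/\ size g = size s, folds s g & size (undup g) = (size s)./2.+1].

End Walks.

(** * Adopted sequences as folded walks with the most vertices *)

Section Treelike.

(** The freshness clauses are the equality case of the vertex bound: each deletion must lose exactly
    one vertex. Equality refers to no particular block, so it passes to the deletion of any adjacent
    block, as the recursion demands. *)
Let adoptedF_treelike fuel s g : pairing s -> noncrossing s -> 1 < size s ->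
  size s <= fuel -> size g = size s -> adoptedF fuel s g <-> treelike 0 s g.
Proof.
elim: fuel s g => [|fuel IH] s g sP nc s2 hf sg; first lia.
have ev := pairing_even sP.
rewrite /=; case: eqVneq => [e2|ne2].
  have [p0 p0' _] := sP 0 ltac:(lia); have [p1 p1' _] := sP 1 ltac:(lia).
  have s0E : nth 0 s 0 = 1 by lia.
  have s1E : nth 0 s 1 = 0 by lia.
  have gf : folds 0 s g.
    move=> j; rewrite e2; case: j => [|[|//]] _; rewrite ?s0E ?s1E /edge /= sg e2 //.
  move: sg gf; rewrite e2; case: g => [|a [|b [|//]]] //= _ gf.
  rewrite /treelike /= mem_seq1.
  split=> [/eqP ab|[_ _]]; first by split=> //; rewrite e2 // (negbTE ab).
  by rewrite e2; case: (a =P b).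
have gt2 : 2 < size s by lia.
have IHm m (ms : m.+2 < size s) (sm : nth 0 s m = m.+1) :
    adoptedF fuel (del_block m s) (take m.+1 g ++ drop m.+3 g) <->
    treelike 0 (del_block m s) (del_vertex m g).
  apply: IH; rewrite ?size_del_block ?size_del_vertex ?sg //; try lia.
  - exact: pairing_del.
  - exact/noncrossing_del.
split=> [H|[_ gf gV] m ms sm].
  have [m ms sm] := exists_adj_block sP nc gt2.
  have [gm gfresh /(IHm m ms sm) [_ gf' gV]] := H m ms sm.
  split=> //; first exact/(folds_del 0 ms sP sm sg).
  rewrite (size_undup_cons_notin (mem_del_vertex _ gm)) ?sg // gV.
  rewrite size_del_block; last lia.
  suff -> : nth 0 g m.+1 \notin del_vertex m g by lia.
  apply/negP => /(nthP 0) [j]; rewrite size_del_vertex ?sg // => hj.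
  have [_ ne] := skip_neq m.+1 j; have [ne' _] := skip_neq m.+1 j.
  rewrite nth_del_vertex ?sg // => e.
  apply: (gfresh (skip m.+1 j)) => //.
  by rewrite /skip; case: ifP; lia.
have [gm gf'] := (folds_del 0 ms sP sm sg).1 gf.
have sd : size (del_block m s) = size s - 2 by rewrite size_del_block //; lia.
have sdv : size (del_vertex m g) = size s - 2 by rewrite size_del_vertex ?sg.
have dP := pairing_del ms sP sm.
have dnc := (noncrossing_del ms sP sm).2 nc.
have gEi := mem_del_vertex (ltac:(lia) : m.+2 < size g) gm.
(* The reduced walk obeys the vertex bound, so the full count forces the deleted vertex to be
   new. *)
have hU := folds_size_undup dP dnc (ltac:(lia)) (etrans sdv (esym sd)) gf'.
have := size_undup_cons_notin gEi; rewrite gV; move: hU; rewrite sd.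
case: (boolP (_ \notin _)) => [fresh hU e|]; last by move=> _ /=; lia.
split=> //.
- move=> t ht tm e'.
  have : nth 0 g t \in del_vertex m g; last by rewrite -e' (negbTE fresh).
  have [->|ne2'] := eqVneq t m.+2.
    rewrite -gm; apply/(nthP 0); exists m; first by rewrite sdv; lia.
    by rewrite nth_del_vertex ?sg // /skip ltnSn.
  apply/(nthP 0); exists (close m.+1 t).
    by rewrite sdv /close; case: ifP; lia.
  by rewrite nth_del_vertex ?sg // closeK //; lia.
- by apply/IHm => //; split=> //; [rewrite sd sdv | move: e; rewrite /= sd; lia].
Qed.

(** Deletion is inverted: at an adjacent block, an excursion to a new vertex [v] and back is
    inserted into a walk for the smaller pairing. *)
Let exists_treelike s : pairing s -> noncrossing s -> 1 < size s ->
  exists g : seq nat, treelike 0 s g.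
Proof.
have [n] := ubnP (size s); elim: n s => // n IH s hn sP nc s2.
have ev := pairing_even sP.
have [le2|gt2] := leqP (size s) 2.
  have e2 : size s = 2 by lia.
  have [p0 p0' _] := sP 0 ltac:(lia); have [p1 p1' _] := sP 1 ltac:(lia).
  have s0E : nth 0 s 0 = 1 by lia.
  have s1E : nth 0 s 1 = 0 by lia.
  exists [:: 0; 1]; split; rewrite ?e2 // => j; rewrite e2.
  by case: j => [|[|//]] _; rewrite ?s0E ?s1E.
have [m ms sm] := exists_adj_block sP nc gt2.
have sd : size (del_block m s) = size s - 2 by rewrite size_del_block //; lia.
have [g' [sg' gf' gV']] := IH (del_block m s) ltac:(lia) (pairing_del ms sP sm)
  ((noncrossing_del ms sP sm).2 nc) ltac:(lia).
have st : size (take m.+1 g') = m.+1 by rewrite size_takel // sg' sd; lia.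
have sg0 : m.+1 + 2 + (size g' - m.+1) = size s by rewrite sg' sd; lia.
pose v := (\max_(x <- g') x).+1.
have vfresh : v \notin g'.
  by apply/negP => /(@leq_bigmax_seq _ g' xpredT id v) => /(_ isT); rewrite ltnn.
pose g := take m.+1 g' ++ [:: v; nth 0 g' m] ++ drop m.+1 g'.
have sg : size g = size s by rewrite !size_cat st size_drop /= addnA.
have gE : del_vertex m g = g'.
  rewrite /del_vertex /g take_size_cat // drop_cat st ltnNge (_ : m.+1 <= m.+3); last lia.
  by rewrite (_ : m.+3 - m.+1 = 2) /=; [rewrite drop0 cat_take_drop | lia].
have gm1 : nth 0 g m.+1 = v by rewrite nth_cat st ltnn subnn.
have gm : nth 0 g m = nth 0 g m.+2.
  rewrite !nth_cat st ltnSn ltnNge leqnSn /= (_ : m.+2 - m.+1 = 1); last lia.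
  by rewrite /= nth_take.
exists g; split=> //.
  by apply/(folds_del 0 ms sP sm sg); rewrite gE.
have := size_undup_cons_notin (mem_del_vertex (ltac:(lia) : m.+2 < size g) gm).
by rewrite gm1 gE vfresh gV' sd => ->; lia.
Qed.

Lemma Gseq_treelike s : pairing s -> noncrossing s -> 1 < size s ->
  treelike 0 s (Gseq s).
Proof.
move=> sP nc s2; have [g gT] := exists_treelike sP nc s2.
have : adopted s (Gseq s).
  apply: ClassicalEpsilon.epsilon_spec; exists g; split; first by case: gT.
  by apply/adoptedF_treelike => //; case: gT.
by case=> sg /(adoptedF_treelike sP nc s2 (leqnn _) sg).
Qed.

End Treelike.

(* The walk of pairs (g_j, i_j) folds too, so it has no more vertices than g. *)
Lemma treelike_factor (T : eqType) (x0 : T) s (g : seq nat) (i : seq T) a b :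
  pairing s -> noncrossing s -> 1 < size s -> treelike 0 s g ->
  size i = size s -> folds x0 s i -> a < size s -> b < size s ->
  nth 0 g a = nth 0 g b -> nth x0 i a = nth x0 i b.
Proof.
move=> sP nc s2 [sg gf gV] si ifo ha hb gab.
pose z := zip g i.
have sgi : size g = size i by rewrite sg si.
have sz : size z = size s by rewrite size_zip sg si minnn.
have zf : folds (0, x0) s z.
  move=> j hj; have := gf j hj; have := ifo j hj.
  by rewrite /edge sz sg si /= !nth_zip // => -> ->.
have hU := folds_size_undup sP nc s2 sz zf.
have sub : {subset undup g <= [seq x.1 | x <- undup z]}.
  move=> y; rewrite mem_undup => /(nthP 0) [j hj <-]; apply/mapP.
  exists (nth (0, x0) z j); last by rewrite nth_zip.
  by rewrite mem_undup mem_nth // sz -sg.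
(* The zipped walk has at most as many vertices as [g] and projects onto all of them, so the
   projection is injective on vertices. *)
have un := leq_size_uniq (undup_uniq g) sub; rewrite size_map gV in un.
have {}un := un hU.
have inz c : c < size s -> (nth 0 g c, nth x0 i c) \in undup z.
  by move=> hc; rewrite mem_undup -nth_zip // mem_nth ?sz.
have ia := inz a ha; have ib := inz b hb.
suff : (nth 0 g a, nth x0 i a) = (nth 0 g b, nth x0 i b) by case.
rewrite -[LHS](nth_index (0, x0) ia) -[RHS](nth_index (0, x0) ib); congr nth.
apply/eqP; rewrite -(nth_uniq 0 _ _ un) ?size_map ?index_mem //.
by rewrite !(nth_map (0, x0)) ?index_mem // !nth_index //=; apply/eqP.
Qed.

(** * Edges of a treelike walk *)

Definition uedge (g : seq nat) j :=
  (minn (edge 0 g j).1 (edge 0 g j).2, maxn (edge 0 g j).1 (edge 0 g j).2).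

Definition loopless (e : nat * nat) := e.1 != e.2.

Lemma edgesE g : edges g = undup [seq uedge g j | j <- iota 0 (size g)].
Proof. by []. Qed.

Lemma walk_vertices_le (g : seq nat) n : n < size g ->
  size (undup (take n.+1 g)) <=
  (size (undup [seq e <- [seq uedge g j | j <- iota 0 n] | loopless e])).+1.
Proof.
elim: n => [|n IH] hn; first by case: g hn => // x g _; rewrite /= take0.
have {}IH := IH (ltnW hn).
have inW t : t <= n -> nth 0 g t \in take n.+1 g.
  move=> ht; have htn : t < n.+1 by [].
  by rewrite -(nth_take 0 htn) mem_nth // size_takel // ltnW.
rewrite (take_nth 0) //; set W := take n.+1 g in IH inW *; set v := nth 0 g n.+1.
rewrite -[in iota 0 n.+1]addn1 iotaD add0n map_cat filter_cat /= .
set E := [seq e <- [seq uedge g j | j <- iota 0 n] | loopless e] in IH *.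
have wn := inW n (leqnn n).
have -> : size (undup (rcons W v)) = (v \notin W) + size (undup W).
  by apply: size_undup_cons_notin => y; rewrite mem_rcons.
have eE : uedge g n = (minn (nth 0 g n) v, maxn (nth 0 g n) v).
  by rewrite /uedge /edge /= modn_small.
case: (boolP (v \in W)) => [_|vW] /=.
  rewrite add0n (leq_trans IH) // ltnS uniq_leq_size ?undup_uniq // => y.
  by rewrite !mem_undup mem_cat => ->.
have vn : nth 0 g n != v by apply: contraNneq vW => <-.
have ll : loopless (uedge g n) by rewrite eE /loopless /=; move/eqP: vn; lia.
rewrite ll.
have -> : size (undup (E ++ [:: uedge g n])) = (uedge g n \notin E) + size (undup E).
  by apply: size_undup_cons_notin => y; rewrite mem_cat mem_seq1 in_cons orbC.
suff -> : uedge g n \notin E by rewrite !add1n ltnS.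
apply/negP; rewrite mem_filter => /andP [_ /mapP [j]]; rewrite mem_iota => /= hj.
rewrite eE /uedge /edge /= modn_small; last lia.
move=> [e1 e2].
have : v = nth 0 g j \/ v = nth 0 g j.+1 by clear -e1 e2; lia.
by case=> e; move: vW; rewrite e inW // ltnW.
Qed.

Section TreelikeEdges.
Variables (s g : seq nat).
Hypotheses (sP : pairing s) (s2 : 1 < size s) (gT : treelike 0 s g).

Let openers := [seq j <- iota 0 (size s) | j < nth 0 s j].

Lemma size_openers : size openers = (size s)./2.
Proof.
rewrite -[in RHS](card_involution_lt (partnerK sP) (partner_neq_id sP)) doubleK.
rewrite size_filter -sum1_count -sum1_card -[X in iota _ X](subn0 (size s)).
by rewrite -[iota _ _]/(index_iota _ _) big_mkord.
Qed.

Let openers_edges : [seq uedge g j | j <- openers] =i edges g.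
Proof.
have [sg gf _] := gT.
have flip j : j < size s -> edge 0 g (nth 0 s j) = ((edge 0 g j).2, (edge 0 g j).1).
  move=> hj; have [h1 _ h3] := sP hj; have := gf j hj; have := gf _ h1.
  by rewrite h3 => e1 e2; rewrite e2 -e1; case: (edge 0 g _).
move=> e; rewrite edgesE mem_undup; apply/mapP/mapP => [[j]|[j]].
  by rewrite mem_filter sg => /andP [_ hj] ->; exists j.
rewrite mem_iota /= sg add0n => hj ->; have [h1 h2 h3] := sP hj.
have [lt|ge] := ltnP j (nth 0 s j).
  by exists j => //; rewrite mem_filter lt mem_iota add0n.
exists (nth 0 s j); first by rewrite mem_filter h3 mem_iota add0n h1 ltn_neqAle ge !andbT; apply/eqP.
by rewrite /uedge flip //= minnC maxnC.
Qed.

(** All [k/2 + 1] vertices are visited before the closing step, which takes [k/2] different proper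
    edges. *)
Let loopless_edges_ge : (size s)./2 <= size [seq e <- edges g | loopless e].
Proof.
have [sg _ gV] := gT.
have g0 : 0 < size g by rewrite sg ltnW.
have := @walk_vertices_le g (size g).-1; rewrite prednK // => /(_ (leqnn _)).
rewrite take_size gV.
rewrite ltnS => /leq_trans; apply; apply: uniq_leq_size; first exact: undup_uniq.
move=> e; rewrite mem_undup !mem_filter edgesE mem_undup => /andP [-> /mapP [j]] /=.
rewrite mem_iota => /= hj ->; apply: map_f.
by rewrite mem_iota (leq_trans hj) // leq_pred.
Qed.

(** The [k/2] block edges cover an edge set of at least [k/2] elements, so no two of them
    coincide. *)
Let openers_uniq : uniq [seq uedge g j | j <- openers].
Proof.
have ue : uniq (edges g) by rewrite edgesE undup_uniq.
apply: (leq_size_uniq ue); first by move=> e; rewrite openers_edges.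
rewrite size_map size_openers (leq_trans loopless_edges_ge) //.
by rewrite size_filter count_size.
Qed.

Lemma loopless_edges e : e \in edges g -> e.1 != e.2.
Proof.
have : all loopless (edges g); last by move=> /allP H /H.
rewrite all_count eqn_leq count_size -size_filter (leq_trans _ loopless_edges_ge) //.
rewrite -size_openers -(size_map (uedge g)); apply: uniq_leq_size.
  exact: undup_uniq.
by move=> e'; rewrite openers_edges.
Qed.

Lemma perm_openers_edges : perm_eq [seq uedge g j | j <- openers] (edges g).
Proof.
by apply: uniq_perm; [exact: openers_uniq|exact: undup_uniq|exact: openers_edges].
Qed.

End TreelikeEdges.

(** * Counting tuples with prescribed edge equivalences *)

Lemma card_fiber_le (T T' : finType) (A : {set T}) (f : T -> T') K :
  (forall y, y \in f @: A -> #|[set x in A | f x == y]| <= K) ->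
  #|A| <= K * #|f @: A|.
Proof.
move=> fK; rewrite -sum1_card (partition_big f [in f @: A]) /=; last first.
  by move=> x xA; rewrite imset_f.
rewrite mulnC -sum_nat_const; apply: leq_sum => y yA.
rewrite (leq_trans _ (fK y yA)) // -sum1_card; apply: eq_leq; apply: eq_bigl => x.
by rewrite inE.
Qed.

Section Windows.
Variables (N k : nat) (x0 : 'I_N) (a : nat).
Hypothesis k0 : 0 < k.
Implicit Types (v : k.-tuple 'I_N) (D : {set k.-tuple 'I_N}).

Definition visit v y := nth x0 v (y %% k).

(** The part of the closed walk revealed after [t] steps from position [a]. Tuples are counted by
    letting these images grow one vertex at a time. *)
Definition window t v : t.+1.-tuple 'I_N := [tuple visit v (a + x) | x < t.+1].

Lemma nth_window t v x : x <= t -> nth x0 (window t v) x = visit v (a + x).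
Proof.
by move=> xt; rewrite (nth_mktuple _ _ (Ordinal (xt : x < t.+1))).
Qed.

Lemma edge_visit v y : edge x0 v (y %% k) = (visit v y, visit v y.+1).
Proof. by rewrite /edge size_tuple /visit -addn1 modnDml addn1. Qed.

Lemma card_window_step D t K (S : t.+1.-tuple 'I_N -> {set 'I_N}) :
  (forall v, v \in D -> visit v (a + t.+1) \in S (window t v)) ->
  (forall w, #|S w| <= K) ->
  #|window t.+1 @: D| <= K * #|window t @: D|.
Proof.
move=> DS SK; pose f (w : t.+2.-tuple 'I_N) := [tuple nth x0 w x | x < t.+1].
have fw v : f (window t.+1 v) = window t v.
  by apply: eq_from_tnth => x; rewrite !tnth_mktuple nth_window // ltnW.
have fE : f @: (window t.+1 @: D) = window t @: D.
  by rewrite -imset_comp; apply: eq_imset => v /=.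
rewrite -fE; apply: card_fiber_le => y _.
rewrite (leq_trans _ (SK y)) //.
pose lst (w : t.+2.-tuple 'I_N) := nth x0 w t.+1.
rewrite -(card_in_imset (f := lst)); last first.
  move=> w w'; rewrite !inE => /andP [_ /eqP e1] /andP [_ /eqP e2] el.
  apply: val_inj; apply: (@eq_from_nth _ x0); rewrite !size_tuple // => x.
  rewrite ltnS leq_eqVlt => /predU1P [->//|xt].
  have : tnth (f w) (Ordinal xt) = tnth (f w') (Ordinal xt) by rewrite e1 e2.
  by rewrite !tnth_mktuple.
apply: subset_leq_card; apply/fintype.subsetP => z /imsetP [w].
rewrite inE => /andP [/imsetP [v vD ->]]; rewrite fw => /eqP <- ->.
by rewrite /lst nth_window // DS.
Qed.

Lemma card_window D : #|D| <= #|window k.-1 @: D|.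
Proof.
rewrite card_in_imset // => v v' _ _ e.
apply: val_inj; apply: (@eq_from_nth _ x0); rewrite !size_tuple // => y yk.
pose x := (y + (k - a %% k)) %% k.
have xk : x <= k.-1 by rewrite -ltnS prednK // ltn_mod.
have := congr1 (fun w => nth x0 (tval w) x) e; rewrite !nth_window // /visit.
suff -> : (a + x) %% k = y by [].
have ak : a %% k <= k by rewrite ltnW // ltn_mod.
by rewrite /x modnDmr addnCA -modnDmr -(modnDml a) subnKC // modnn addn0 modn_small.
Qed.

Variables (r : rel ('I_N * 'I_N)) (B : nat).
Hypothesis rB : forall p q q' : 'I_N, #|[set s | r (p, q) (q', s)]| <= B.
Hypothesis B0 : 0 < B.

Lemma card_window_free D t : #|window t.+1 @: D| <= N * #|window t @: D|.
Proof.
apply: (card_window_step (S := fun=> [set: 'I_N])) => [v _|w]; first by rewrite inE.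
by rewrite cardsT card_ord.
Qed.

(** Both ends of edge [x] and the start of edge [t] lie in the window, so (C2) leaves at most [B]
    choices for the next vertex. *)
Lemma card_window_linked D t x : x < t ->
  (forall v, v \in D -> r (edge x0 v ((a + x) %% k)) (edge x0 v ((a + t) %% k))) ->
  #|window t.+1 @: D| <= B * #|window t @: D|.
Proof.
move=> xt Dr; apply: (card_window_step (S := fun w =>
  [set s | r (nth x0 w x, nth x0 w x.+1) (nth x0 w t, s)])) => [v vD|w].
  by rewrite inE !nth_window ?(ltnW xt) //; have := Dr v vD; rewrite !edge_visit !addnS.
exact: rB.
Qed.

Lemma card_window_walk D (free : pred nat) t0 n :
  (forall t, t0 <= t -> t < t0 + n -> ~~ free t -> exists2 x, x < t &
     forall v, v \in D -> r (edge x0 v ((a + x) %% k)) (edge x0 v ((a + t) %% k))) ->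
  #|window (t0 + n) @: D| <=
    #|window t0 @: D| * N ^ count free (iota t0 n) * B ^ n.
Proof.
elim: n => [|n IH] H; first by rewrite addn0 !muln1.
have {}IH := IH (fun t h1 h2 => H t h1 (leq_trans h2 (leq_add (leqnn _) (leqnSn _)))).
rewrite addnS -[in iota _ _]addn1 iotaD count_cat /= addn0.
have [fr|nf] := boolP (free (t0 + n)).
  rewrite (leq_trans (card_window_free _ _)) // (leq_trans (leq_mul (leqnn N) IH)) //.
  by rewrite addn1 expnS mulnA leq_mul ?leq_pexp2l // mulnCA.
have [x xt Dx] := H (t0 + n) (leq_addr _ _) (ltac:(lia)) nf.
rewrite (leq_trans (card_window_linked xt Dx)) //.
rewrite (leq_trans (leq_mul (leqnn B) IH)) //.
by rewrite addn0 mulnCA -expnS.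
Qed.

(** Only [k.-1] steps are taken, since the last edge closes the walk and brings no new vertex. *)
Lemma card_walk D (free : pred nat) t0 : t0 < k ->
  (forall t, t0 <= t -> t < k.-1 -> ~~ free t -> exists2 x, x < t &
     forall v, v \in D -> r (edge x0 v ((a + x) %% k)) (edge x0 v ((a + t) %% k))) ->
  #|D| <= #|window t0 @: D| * N ^ count free (iota t0 (k.-1 - t0)) * B ^ k.
Proof.
move=> t0k H; apply: (leq_trans (card_window D)).
have e : t0 + (k.-1 - t0) = k.-1 by lia.
have W := @card_window_walk D free t0 (k.-1 - t0); rewrite e in W.
apply: (leq_trans (W H)).
by rewrite leq_mul2l leq_pexp2l ?orbT //; lia.
Qed.

End Windows.

Section RotatedPairing.
Variables (s : seq nat) (a : nat).
Hypotheses (sP : pairing s) (ak : a < size s).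
Let k := size s.

(* The pairing as seen from position [a], so that a walk may start at any block. *)
Definition rpartner t := (nth 0 s ((a + t) %% k) + (k - a)) %% k.

Let k0 : 0 < k. Proof. exact: leq_ltn_trans ak. Qed.

Lemma rpartner_lt t : rpartner t < k.
Proof. by rewrite ltn_mod. Qed.

Lemma rpartnerE t : (a + rpartner t) %% k = nth 0 s ((a + t) %% k).
Proof.
rewrite /rpartner modnDmr addnCA subnKC ?(ltnW ak) // modnDr modn_small //.
by case: (sP (ltn_pmod (a + t) k0)).
Qed.

Lemma rpartnerK t : t < k -> rpartner (rpartner t) = t.
Proof.
move=> tk; rewrite {1}/rpartner rpartnerE.
have [_ _ ->] := sP (ltn_pmod (a + t) k0).
by rewrite modnDml addnAC subnKC ?(ltnW ak) // addnC modnDr modn_small.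
Qed.

Lemma rpartner_neq t : rpartner t <> t.
Proof.
move=> e; have [_ /[swap] _] := sP (ltn_pmod (a + t) k0).
by rewrite -rpartnerE e.
Qed.

Lemma count_free : count (fun t => t < rpartner t) (iota 0 k) = k./2.
Proof.
pose q (t : 'I_k) : 'I_k := Ordinal (rpartner_lt t).
have qK : involutive q by move=> t; apply: val_inj; rewrite /= rpartnerK.
have qn t : q t != t by apply/eqP => /(congr1 val) /=; exact: rpartner_neq.
rewrite -[in RHS](card_involution_lt qK qn) doubleK.
by rewrite -sum1_count -sum1_card -[in iota _ _](subn0 k) -/(index_iota _ _) big_mkord.
Qed.

End RotatedPairing.

Section CountPairing.
Variables (N : nat) (x0 : 'I_N) (r : rel ('I_N * 'I_N)) (B : nat).
Hypothesis r_equiv : equivalence_rel r.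
Hypothesis r_flip : forall p q : 'I_N, r (p, q) (q, p).
Hypothesis rB : forall p q q' : 'I_N, #|[set s | r (p, q) (q', s)]| <= B.
Hypothesis B0 : 0 < B.

Lemma r_refl e : r e e. Proof. by have [] := r_equiv e e e. Qed.

Lemma r_sym e f : r e f = r f e.
Proof.
apply/idP/idP => h; first by have [_ /(_ h) <-] := r_equiv e f e; rewrite r_refl.
by have [_ /(_ h) <-] := r_equiv f e f; rewrite r_refl.
Qed.

Lemma r_trans f e h : r e f -> r f h -> r e h.
Proof. by move=> ef fh; have [_ /(_ ef) ->] := r_equiv e f h. Qed.

Let c1 := \max_(p : 'I_N)
  #|[set t : 'I_N * 'I_N * 'I_N | r (p, t.1.1) (t.1.2, t.2)]|.

Let c3 := #|[set t : 'I_N * 'I_N * 'I_N |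
  r (t.1.1, t.1.2) (t.1.2, t.2) && (t.2 != t.1.1)]|.

Definition linked s : {set (size s).-tuple 'I_N} :=
  [set i : (size s).-tuple 'I_N |
    [forall j : 'I_(size s), r (edge x0 i j) (edge x0 i (nth 0 s j))]].

Lemma linkedP s (i : (size s).-tuple 'I_N) :
  reflect (forall j, j < size s -> r (edge x0 i j) (edge x0 i (nth 0 s j)))
          (i \in linked s).
Proof.
rewrite inE; apply: (iffP forallP) => H j; last exact: H.
by move=> hj; have := H (Ordinal hj).
Qed.

(** The first [t0] steps from position [a] are left to the caller, who counts them by (C1) or (C3).
    A step is free when its edge precedes its partner. Of the [k/2] free steps, those among the
    first [t0] no longer contribute; the power of [N] on the left records this without
    subtraction. *)
Lemma card_linked_walk s (D : {set (size s).-tuple 'I_N}) a t0 :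
  pairing s -> a < size s -> t0 < size s -> D \subset linked s ->
  #|D| * N ^ count (fun t => t < rpartner s a t) (iota 0 t0)
    <= #|window x0 a t0 @: D| * N ^ (size s)./2 * B ^ size s.
Proof.
move=> sP ak t0k /fintype.subsetP Ds; set k := size s.
set free := fun t => t < rpartner s a t.
have k0 : 0 < k by exact: leq_ltn_trans ak.
have H : forall t, t0 <= t -> t < k.-1 -> ~~ free t -> exists2 x, x < t &
    forall v, v \in D -> r (edge x0 v ((a + x) %% k)) (edge x0 v ((a + t) %% k)).
  move=> t h1 h2 nf; exists (rpartner s a t).
    by rewrite ltn_neqAle leqNgt nf andbT; apply/eqP; apply: rpartner_neq.
  move=> v /Ds /linkedP vs; rewrite r_sym rpartnerE //; apply: vs.
  exact: ltn_pmod.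
have := card_walk k0 rB B0 t0k H; rewrite -/k => le.
have N0 : 0 < N by case: (N) x0 => // -[].
have cE : count free (iota 0 t0) + count free (iota t0 (k.-1 - t0)) <= k./2.
  have le' : t0 + (k.-1 - t0) <= k by lia.
  rewrite -(count_free sP ak) -/k -count_cat -{2}[t0]add0n -iotaD.
  move: le'; set n := t0 + _ => le'.
  by rewrite -[X in _ <= count _ (iota 0 X)](subnKC le') iotaD count_cat leq_addr.
apply: (leq_trans (leq_mul le (leqnn _))).
rewrite -mulnA [B ^ k * _]mulnC mulnA leq_mul2r; apply/orP; right.
by rewrite -mulnA -expnD leq_mul2l leq_pexp2l ?orbT // addnC.
Qed.

(** Seen from [m], the first three vertices satisfy the relation counted by [c3], and exactly one of
    their two steps is free. Up to powers of [B], the generic bound [N * N^(k/2)] becomes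
    [c3 * N^(k/2 - 1)]. *)
Lemma card_linked_adj s m : pairing s -> m.+2 < size s -> nth 0 s m = m.+1 ->
  #|[set i in linked s | nth x0 i m != nth x0 i m.+2]| * N
    <= c3 * N ^ (size s)./2 * B ^ size s.
Proof.
move=> sP ms sm; set D := [set i in _ | _].
have Ds : D \subset linked s by apply/fintype.subsetP => i; rewrite inE => /andP [].
have := @card_linked_walk s D m 2 sP ltac:(lia) ltac:(lia) Ds.
have r0 : rpartner s m 0 = 1.
  rewrite /rpartner addn0 [m %% _]modn_small ?sm; last lia.
  by rewrite (_ : m.+1 + (size s - m) = 1 + size s) ?modnDr ?modn_small //; lia.
have r1 : rpartner s m 1 = 0 by rewrite -r0 rpartnerK //; lia.
rewrite /= r0 r1 /= expn1 => /leq_trans; apply.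
rewrite !leq_mul2r; do 2 (apply/orP; right).
pose f (w : 3.-tuple 'I_N) := (nth x0 w 0, nth x0 w 1, nth x0 w 2).
rewrite -(card_in_imset (f := f)); last first.
  move=> w w' _ _ [e0 e1 e2]; apply: val_inj; apply: (@eq_from_nth _ x0).
    by rewrite !size_tuple.
  by rewrite size_tuple; case=> [|[|[|]]].
apply: subset_leq_card; apply/fintype.subsetP => z /imsetP [w /imsetP [i iD ->] ->].
move: iD; rewrite !inE => /andP [/forallP iL ne].
rewrite /f !nth_window // /visit addn0 !modn_small ?addn1 ?addn2 //=; try lia.
rewrite eq_sym ne andbT.
have := iL (Ordinal (ltac:(lia) : m < size s)); rewrite /= sm /edge size_tuple.
by rewrite !modn_small //; lia.
Qed.

Let card_c1 : #|[set t : 'I_N * ('I_N * 'I_N * 'I_N) |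
    r (t.1, t.2.1.1) (t.2.1.2, t.2.2)]| <= c1 * N.
Proof.
set A := [set _ | _].
have le : #|[set t.1 | t in A]| <= N by rewrite -[leqRHS]card_ord max_card.
apply: (leq_trans _ (leq_mul (leqnn c1) le)); apply: card_fiber_le => p _.
rewrite -(card_in_imset (f := snd)); last first.
  move=> [p1 t1] [p2 t2]; rewrite !inE /= => /andP [_ /eqP ->] /andP [_ /eqP ->].
  by move=> ->.
apply: (leq_trans _ (leq_bigmax p)).
apply: subset_leq_card; apply/fintype.subsetP => z /imsetP [[q t]].
by rewrite !inE /= => /andP [h /eqP <-] ->.
Qed.

(** The four vertices of the two linked edges form one of at most [c1 * N] quadruples, and the
    [l.-2] vertices between them are arbitrary. The condition [1 < l] keeps the end of the first
    edge and the start of the second at different positions. *)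
Lemma card_window_c1 s (D : {set (size s).-tuple 'I_N}) m l : 1 < l ->
  m + l < size s -> D \subset linked s -> nth 0 s m = m + l ->
  #|window x0 m l.+1 @: D| <= c1 * N ^ l.-1.
Proof.
move=> l1 ml /fintype.subsetP Ds sm.
pose f (w : l.+2.-tuple 'I_N) :=
  ((nth x0 w 1, (nth x0 w 0, nth x0 w l, nth x0 w l.+1)),
   [tuple nth x0 w x.+2 | x < l.-2]).
rewrite -(card_in_imset (f := f)); last first.
  move=> w w' _ _ ff; have [e1 e0 el el1 _] := ff; have et := congr1 snd ff.
  apply: val_inj; apply: (@eq_from_nth _ x0); rewrite !size_tuple // => x xl.
  case: x xl => [//|[//|x]] xl.
  have [xl2|xl2] := ltnP x l.-2.
    have := congr1 (fun t => tnth t (Ordinal xl2)) et; rewrite !tnth_mktuple //.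
  have [->//|->//] : x.+2 = l \/ x.+2 = l.+1 by lia.
apply: (@leq_trans (c1 * N * N ^ l.-2)); last first.
  by rewrite -mulnA -expnS (_ : l.-2.+1 = l.-1) //; lia.
apply: (@leq_trans #|finset.setX [set t : 'I_N * ('I_N * 'I_N * 'I_N) |
    r (t.1, t.2.1.1) (t.2.1.2, t.2.2)] [set: l.-2.-tuple 'I_N]|); last first.
  by rewrite cardsX cardsT card_tuple card_ord leq_mul.
apply: subset_leq_card; apply/fintype.subsetP => z /imsetP [w /imsetP [i /Ds /linkedP iD ->] ->].
rewrite !inE /= andbT !nth_window // /visit addn0 addn1 addnS.
apply: (r_trans (r_flip _ _)).
have ms : m < size s by lia.
have := iD m ms; rewrite sm /edge size_tuple [m %% _]modn_small //.
by rewrite [(m + l) %% _]modn_small.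
Qed.

(** In a shortest block of length [l > 1], every position strictly inside has its partner outside,
    as otherwise a shorter or an adjacent block would appear. Seen from its left end, the first [l]
    edges precede their partners: generically they cost [N^(l+1)], while (C1) leaves
    [c1 * N^(l-1)]. *)
Lemma card_linked_nonadj s : pairing s -> 2 < size s ->
  (forall m, m.+2 < size s -> nth 0 s m <> m.+1) ->
  #|linked s| * N <= c1 * N ^ (size s)./2 * B ^ size s.
Proof.
move=> sP s2 nadj.
(* Length one is excluded explicitly, because [nadj] stops before the last two positions, which may
   still form a block. The block of position 0 is longer. *)
pose Q l := (1 < l) && [exists m : 'I_(size s), nth 0 s m == m + l].
have exQ : exists l, Q l.
  have [h1 h2 h3] := sP 0 ltac:(lia).
  have := nadj 0 s2; exists (nth 0 s 0); apply/andP; split; first lia.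
  by apply/existsP; exists (Ordinal (ltac:(lia) : 0 < size s)).
case: (ex_minnP exQ) => l /andP [l1 /existsP [[m ms] /= /eqP sm]] lmin.
have ml : m + l < size s by have [h1 _ _] := sP m ms; rewrite -sm.
have nin y z : m < y -> y < z -> z < m + l -> nth 0 s y <> z.
  move=> my yz zl e.
  have [z1|z1] := eqVneq z y.+1; first by apply: (nadj y); lia.
  have : Q (z - y); last by move=> /lmin; lia.
  apply/andP; split; first by move/eqP: z1; lia.
  by apply/existsP; exists (Ordinal (ltac:(lia) : y < size s)); rewrite /= e; apply/eqP; lia.
have out t : 0 < t -> t < l -> nth 0 s (m + t) < m \/ m + l < nth 0 s (m + t).
  move=> t0 tl; have [h1 h2 h3] := sP (m + t) ltac:(lia).
  have n1 : nth 0 s (m + t) <> m by move=> e; move: h3; rewrite e sm; lia.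
  have n2 : nth 0 s (m + t) <> m + l.
    by move=> e; have [_ _] := sP m ms; rewrite sm -e h3; lia.
  have n3 := nin (m + t) (nth 0 s (m + t)).
  have n4 := nin (nth 0 s (m + t)) (m + t).
  lia.
have o1 := out 1 isT l1.
have lk : l.+1 < size s.
  by have [h1 _ _] := sP m.+1 ltac:(lia); move: o1; rewrite addn1; lia.
have free t : t < l -> t < rpartner s m t.
  move=> tl; rewrite /rpartner.
  have -> : (m + t) %% size s = m + t by rewrite modn_small //; lia.
  have [h1 h2 h3] := sP (m + t) ltac:(lia).
  case: t tl h1 h2 h3 => [|t] tl h1 h2 h3.
    rewrite addn0 sm (_ : m + l + (size s - m) = l + size s); last lia.
    by rewrite modnDr modn_small //; lia.
  have [lt|gt] := out t.+1 isT tl.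
    by rewrite modn_small; lia.
  rewrite (_ : _ + (size s - m) = (nth 0 s (m + t.+1) - m) + size s); last lia.
  by rewrite modnDr modn_small; lia.
have N0 : 0 < N by case: (N) x0 => // -[].
have := card_linked_walk sP ms lk (fintype.subxx _).
set c := count _ _ => le.
have lc : l <= c.
  rewrite /c -[in iota 0 _](addn1 l) iotaD count_cat (_ : count _ (iota 0 l) = l) ?leq_addr //.
  rewrite -[RHS](size_iota 0); apply/eqP; rewrite -all_count; apply/allP => t.
  by rewrite mem_iota => /= h; apply: free.
have le2 := card_window_c1 l1 ml (fintype.subxx _) sm.
have {}le : #|linked s| * N ^ l <= c1 * N ^ l.-1 * N ^ (size s)./2 * B ^ size s.
  apply: (leq_trans (leq_mul (leqnn _) (leq_pexp2l N0 lc))).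
  by apply: (leq_trans le); rewrite !leq_mul.
have Np : 0 < N ^ l.-1 by rewrite expn_gt0 N0.
rewrite -(leq_pmul2r Np); move: le; rewrite -{1}(prednK (ltnW l1)) expnS.
rewrite mulnA => /leq_trans; apply; apply: eq_leq.
by rewrite -!mulnA mulnCA [X in _ = X]mulnA [c1 * _]mulnC; lia.
Qed.

Definition bad s : {set (size s).-tuple 'I_N} :=
  [set i in linked s | ~~ `[< noncrossing s /\ folds x0 s i >]].

(** Each deletion adds one exceptional set of (C3) and restores one free vertex, which raises the
    exponent from [k/2 - 1] back to [k/2]. The factor [size s] absorbs the accumulated terms, as it
    drops by two with every deletion. *)
Lemma card_bad s : pairing s -> 1 < size s ->
  #|bad s| * N <= size s * B ^ size s * (c1 + c3) * N ^ (size s)./2.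
Proof.
have [n] := ubnP (size s); elim: n s => // n IH s hn sP s2.
have ev := pairing_even sP.
have N0 : 0 < N by case: (N) x0 => // -[].
have [le2|gt2] := leqP (size s) 2.
  have e2 : size s = 2 by lia.
  suff -> : bad s = finset.set0 by rewrite cards0.
  apply/finset.setP => i; rewrite !inE; apply/negP => /andP [_ /negP]; apply.
  apply/asboolP; split=> [a b ha|j hj]; first by have [h1 _ _] := sP a ha; lia.
  have [p0 p0' _] := sP 0 ltac:(lia); have [p1 p1' _] := sP 1 ltac:(lia).
  have s0E : nth 0 s 0 = 1 by lia.
  have s1E : nth 0 s 1 = 0 by lia.
  rewrite /edge /= (_ : size (tval i) = 2); last by rewrite size_tuple.
  by case: j hj => [|[|]]; rewrite ?s0E ?s1E //; lia.
have [/existsP [[m ms] /= /andP [ms2 /eqP sm]]|] :=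
    boolP [exists m : 'I_(size s), (m.+2 < size s) && (nth 0 s m == m.+1)]; last first.
  move=> nadj; apply: (@leq_trans (#|linked s| * N)).
    rewrite leq_mul2r subset_leq_card ?orbT //.
    by apply/fintype.subsetP => i; rewrite inE => /andP [].
  apply: (leq_trans (card_linked_nonadj sP gt2 _)).
    move=> m ms sm; move/negP: nadj; apply; apply/existsP.
    by exists (Ordinal (ltac:(lia) : m < size s)); rewrite /= ms sm eqxx.
  have : 1 * (c1 * N ^ (size s)./2 * B ^ size s) <=
    size s * ((c1 + c3) * N ^ (size s)./2 * B ^ size s).
    by rewrite !leq_mul //; lia.
  rewrite mul1n => /leq_trans; apply; apply: eq_leq.
  by rewrite -!mulnA; congr muln; rewrite mulnA mulnC.
set s' := del_block m s.
have sd : size s' = size s - 2 by rewrite size_del_block //; lia.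
have dP := pairing_del ms2 sP sm.
pose E3 := [set i in linked s | nth x0 i m != nth x0 i m.+2].
pose E2 := [set i in bad s | nth x0 i m == nth x0 i m.+2].
have badU : #|bad s| <= #|E3| + #|E2|.
  apply: (leq_trans _ (leq_card_setU _ _)); apply: subset_leq_card.
  apply/fintype.subsetP => i; rewrite !inE => /andP [-> ->] /=.
  by rewrite orNb.
pose f (i : (size s).-tuple 'I_N) : (size s').-tuple 'I_N :=
  [tuple nth x0 (del_vertex m i) j | j < size s'].
have fE i : f i = del_vertex m i :> seq _.
  apply: (@eq_from_nth _ x0).
    by rewrite size_tuple size_del_vertex size_tuple // sd.
  move=> j; rewrite size_tuple => hj.
  by rewrite (nth_mktuple _ _ (Ordinal hj)).
(* Given [i_m = i_(m+2)], the reduced tuple determines everything except the vertex [i_(m+1)]. *)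
have le2 : #|E2| <= N * #|bad s'|.
  apply: (@leq_trans (N * #|f @: E2|)).
    apply: card_fiber_le => y _.
    rewrite -(card_in_imset (f := fun i : (size s).-tuple 'I_N => nth x0 i m.+1)).
      by rewrite -[leqRHS]card_ord max_card.
    move=> i i'; rewrite !inE => /andP [/andP [_ /eqP im] /eqP fi].
    move=> /andP [/andP [_ /eqP im'] /eqP fi'] e1.
    have fii : del_vertex m i = del_vertex m i' by rewrite -!fE fi fi'.
    apply: val_inj; apply: (@eq_from_nth _ x0); rewrite !size_tuple // => j hj.
    have [->//|ne1] := eqVneq j m.+1.
    have H j' : nth x0 i (skip m.+1 j') = nth x0 i' (skip m.+1 j').
      by rewrite -!nth_del_vertex ?size_tuple // fii.
    have [->|ne2] := eqVneq j m.+2.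
      by rewrite -im -im'; have := H m; rewrite /skip ltnSn.
    by rewrite -(@closeK m.+1 j) //; apply/eqP.
  rewrite leq_mul2l subset_leq_card ?orbT //.
  apply/fintype.subsetP => z /imsetP [i]; rewrite inE.
  move=> /andP [+ /eqP im] ->; rewrite inE => /andP [/linkedP iL /asboolP nf].
  have ed j : j < size s' -> edge x0 (f i) j = edge x0 i (skip m j).
    by move=> hj; rewrite fE edge_del ?size_tuple // -sd.
  rewrite inE; apply/andP; split.
    apply/linkedP => j hj; have [h1 _ _] := dP j hj.
    rewrite !ed // skip_partner -?sd //; apply: iL; apply: skip_lt => //.
    by rewrite -sd.
  apply/asboolP => -[nc' ff]; apply: nf; split; first exact/(noncrossing_del ms2 sP sm).
  by apply/(folds_del x0 ms2 sP sm (size_tuple i)); split=> //; rewrite -fE.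
have le3 := card_linked_adj sP ms2 sm; rewrite -/E3 in le3.
have := IH s' ltac:(lia) dP ltac:(lia).
move: badU le2 le3; move: #|bad s| #|E3| #|E2| #|bad s'| => b e3 e2 b' badU le2 le3.
rewrite sd => le'.
set k := size s in le' le3 ev gt2 *; set h := k./2 in le3 *.
have hE : (k - 2)./2 = h.-1 by rewrite /h; clear -gt2 ev; lia.
have h0 : 0 < h by rewrite /h; clear -gt2 ev; lia.
apply: (@leq_trans ((e3 + e2) * N)); first by rewrite leq_mul2r badU orbT.
rewrite mulnDl.
have le4 : e2 * N <= (k - 2) * B ^ k * (c1 + c3) * N ^ h.
  apply: (@leq_trans (N * (b' * N))); first by rewrite mulnA leq_mul2r le2 orbT.
  apply: (leq_trans (leq_mul (leqnn N) le')).
  rewrite hE mulnCA -expnS prednK // leq_mul2r; apply/orP; right.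
  rewrite leq_mul2r; apply/orP; right; rewrite leq_mul2l; apply/orP; right.
  by rewrite leq_pexp2l // leq_subr.
apply: (leq_trans (leq_add le3 le4)).
have le5 : c3 * N ^ h * B ^ k <= 2 * B ^ k * (c1 + c3) * N ^ h.
  rewrite -mulnA [N ^ h * _]mulnC mulnA leq_mul2r; apply/orP; right.
  rewrite mulnC -mulnA mulnCA leq_mul2l; apply/orP; right; clear; lia.
apply: (leq_trans (leq_add le5 (leqnn _))).
rewrite -!mulnA -mulnDl subnKC //; exact: ltnW.
Qed.

(** * Number of edge classes of a tuple *)

Section Patterns.
Variable k : nat.
Implicit Types (i : k.-tuple 'I_N).

(* Sends a position to the first one with an equivalent edge; fixed points count classes. *)
Definition pattern i : {ffun 'I_k -> 'I_k} :=
  [ffun j : 'I_k => [arg min_(l < j | r (edge x0 i l) (edge x0 i j)) val l]].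

Definition nclasses i := #|[pred j | pattern i j == j]|.

Lemma patternP i j : [/\ r (edge x0 i (pattern i j)) (edge x0 i j), pattern i j <= j &
  forall l : 'I_k, r (edge x0 i l) (edge x0 i j) -> pattern i j <= l].
Proof.
rewrite /pattern ffunE; case: arg_minnP; first exact: r_refl.
by move=> l rl lmin; split=> //; apply: lmin; apply: r_refl.
Qed.

Lemma pattern_eq i j l : (pattern i j == pattern i l) = r (edge x0 i j) (edge x0 i l).
Proof.
have [j1 _ j3] := patternP i j; have [l1 _ l3] := patternP i l.
apply/eqP/idP => [e|rjl].
  by apply: r_trans l1; rewrite -e r_sym.
apply: val_inj; apply/eqP; rewrite eqn_leq; apply/andP; split.
  by apply: j3; apply: (r_trans l1); rewrite r_sym.
by apply: l3; apply: (r_trans j1).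
Qed.

Lemma pattern_idem i j : pattern i (pattern i j) = pattern i j.
Proof. by apply/eqP; rewrite pattern_eq; case: (patternP i j). Qed.

(** Each class costs at most one new vertex, each repetition at most [B] choices; the additional
    factor [N] is the starting vertex. *)
Lemma card_pattern (f : {ffun 'I_k -> 'I_k}) : 0 < k ->
  #|[set i | pattern i == f]| <= N ^ (#|[pred j | f j == j]|).+1 * B ^ k.
Proof.
move=> k0; set D := [set i | _].
have [->|[v0 v0D]] := set_0Vmem D; first by rewrite cards0.
have fE v : v \in D -> f = pattern v by rewrite inE => /eqP.
pose free t := if insub t is Some j then f j == j else true.
have H : forall t, 0 <= t -> t < k.-1 -> ~~ free t -> exists2 x, x < t &
    forall v : k.-tuple 'I_N, v \in D -> r (edge x0 v ((0 + x) %% k)) (edge x0 v ((0 + t) %% k)).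
  move=> t _ tk; have tk' : t < k by rewrite (leq_trans tk) // leq_pred.
  rewrite /free insubT => fne.
  exists (f (Ordinal tk')).
    have [_ le _] := patternP v0 (Ordinal tk'); rewrite (fE v0) //.
    rewrite ltn_neqAle le andbT; apply: contra fne => /eqP e.
    by rewrite (fE v0) //; apply/eqP/val_inj.
  move=> v vD; rewrite !add0n !modn_small //; rewrite (fE v) //.
  by case: (patternP v (Ordinal tk')).
have := card_walk k0 rB B0 k0 H; rewrite subn0 => /leq_trans; apply.
have N0 : 0 < N by case: (N) x0 => // -[].
rewrite leq_mul2r expnS; apply/orP; right; apply: leq_mul.
  by rewrite (leq_trans (max_card _)) // card_tuple card_ord expn1.
rewrite leq_pexp2l //; have kp : k.-1 <= k by rewrite leq_pred.
apply: (@leq_trans (count free (iota 0 k))).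
  by rewrite -[X in _ <= count _ (iota 0 X)](subnKC kp) iotaD count_cat leq_addr.
rewrite -sum1_count -sum1_card -[in iota _ _](subn0 k) -/(index_iota _ _) big_mkord.
apply: eq_leq; apply: eq_bigl => j; rewrite /free insubT //= => h.
by congr (_ == _); [congr (f _)|]; apply: val_inj.
Qed.

(** Fewer than [k/2] classes plus the starting vertex give an exponent of at most [(k+1)/2] rounded
    down, which is short of [k/2 + 1] by at least one half. There are at most [k^k] patterns. *)
Lemma card_few : 0 < k ->
  #|[set i | (nclasses i).*2 < k]| <= k ^ k * (N ^ (k.+1)./2 * B ^ k).
Proof.
move=> k0; have N0 : 0 < N by case: (N) x0 => // -[].
set A := [set _ | _].
have le : #|[set pattern i | i in A]| <= k ^ k.
  by rewrite (leq_trans (max_card _)) // card_ffun !card_ord.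
rewrite mulnC; apply: (leq_trans _ (leq_mul (leqnn _) le)).
apply: card_fiber_le => f /imsetP [i0]; rewrite inE => few fE.
apply: (@leq_trans #|[set i | pattern i == f]|).
  by apply: subset_leq_card; apply/fintype.subsetP => i; rewrite !inE => /andP [].
apply: (leq_trans (card_pattern f k0)); rewrite leq_mul2r leq_pexp2l ?orbT //.
move: few; rewrite /nclasses fE; move: #|_| => c; lia.
Qed.

Lemma sum_classes i :
  \sum_(j | pattern i j == j) #|[pred l : 'I_k | r (edge x0 i j) (edge x0 i l)]| = k.
Proof.
transitivity (\sum_(l < k) 1); last by rewrite sum1_card card_ord.
rewrite [RHS](partition_big (pattern i) (fun j => pattern i j == j)) /=; last first.
  by move=> j _; rewrite pattern_idem.
apply: eq_bigr => j /eqP jE; rewrite -sum1_card; apply: eq_bigl => l.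
by rewrite inE -pattern_eq jE eq_sym.
Qed.

(** No class is a singleton and there are at least [k/2] of them, so one class with three positions
    would push the total above [k]. *)
Lemma class_size_two i :
  (forall j : 'I_k, exists2 l : 'I_k, l != j & r (edge x0 i j) (edge x0 i l)) ->
  k <= (nclasses i).*2 ->
  forall j : 'I_k, #|[pred l : 'I_k | r (edge x0 i j) (edge x0 i l)]| = 2.
Proof.
move=> ns few.
pose c (j : 'I_k) := #|[pred l : 'I_k | r (edge x0 i j) (edge x0 i l)]|.
have c2 j : 2 <= c j.
  have [l lj rl] := ns j; rewrite /c -[2](_ : #|[set j; l]| = 2); last by rewrite cards2 eq_sym lj.
  apply: subset_leq_card; apply/fintype.subsetP => y; rewrite !inE.
  by case/orP => /eqP -> //; apply: r_refl.
have cP j : c (pattern i j) = c j.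
  apply: eq_card => l; rewrite !inE; have [rj _ _] := patternP i j.
  by have [_ /(_ rj) ->] := r_equiv (edge x0 i (pattern i j)) (edge x0 i j) (edge x0 i l).
have sumc : \sum_(j | pattern i j == j) c j = k := sum_classes i.
have fixc j : pattern i j == j -> c j = 2.
  move=> jj; apply/eqP; rewrite eqn_leq c2 andbT leqNgt; apply/negP => c3j.
  have : \sum_(l | pattern i l == l) 2 < \sum_(l | pattern i l == l) c l.
    rewrite (bigD1 j) //= [ltnRHS](bigD1 j) //= -addSn leq_add //.
    by apply: leq_sum => l _; apply: c2.
  by rewrite sumc sum_nat_const muln2 -/(nclasses i) ltnNge few.
by move=> j; rewrite -[LHS]/(c j) -cP fixc // pattern_idem.
Qed.

Lemma exists_matching i :
  (forall j : 'I_k, exists2 l : 'I_k, l != j & r (edge x0 i j) (edge x0 i l)) ->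
  k <= (nclasses i).*2 ->
  exists2 p : {ffun 'I_k -> 'I_k}, forall j, p j != j /\ p (p j) = j &
    forall j l : 'I_k, r (edge x0 i j) (edge x0 i l) = (l == j) || (l == p j).
Proof.
move=> ns few; have c2 := class_size_two ns few.
pose p : {ffun 'I_k -> 'I_k} :=
  [ffun j : 'I_k => odflt j [pick l : 'I_k | (l != j) && r (edge x0 i j) (edge x0 i l)]].
have pP (j : 'I_k) : p j != j /\ r (edge x0 i j) (edge x0 i (p j)).
  rewrite /p ffunE; case: pickP => [l /andP [] //|] /=.
  by have [l lj rl] := ns j => /(_ l); rewrite lj rl.
have pE (j l : 'I_k) : r (edge x0 i j) (edge x0 i l) = (l == j) || (l == p j).
  have [pj rpj] := pP j.
  have sub : [set j; p j] \subset [set l : 'I_k | r (edge x0 i j) (edge x0 i l)].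
    by apply/fintype.subsetP => y; rewrite !inE => /orP [] /eqP -> //; apply: r_refl.
  have /eqP e : [set j; p j] == [set l : 'I_k | r (edge x0 i j) (edge x0 i l)].
    by rewrite eqEcard sub cards2 eq_sym pj cardsE c2.
  by move/finset.setP: e => /(_ l); rewrite !inE.
exists p => // j; have [pj rpj] := pP j; split=> //.
have : r (edge x0 i (p j)) (edge x0 i j) by rewrite r_sym.
by rewrite pE eq_sym (negbTE pj) => /eqP.
Qed.

End Patterns.
End CountPairing.

Import Order.TTheory GRing.Theory Num.Theory.
Import numFieldNormedType.Exports.
Local Open Scope classical_set_scope.
Local Open Scope ring_scope.

(** * Iterated integrals as limits of Riemann sums *)

(* No measurability is assumed: the integral of a nonnegative function is a supremum
   over the simple functions below it. *)
Lemma ge0_le_integral_nomeas d (T : measurableType d) (R : realType)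
    (mu : {measure set T -> \bar R}) (D : set T) (f g : T -> \bar R) :
  (forall x, D x -> 0 <= f x)%E -> (forall x, D x -> f x <= g x)%E ->
  (\int[mu]_(x in D) f x <= \int[mu]_(x in D) g x)%E.
Proof.
move=> f0 fg; have g0 x : D x -> (0 <= g x)%E by move=> Dx; exact: le_trans (f0 x Dx) (fg x Dx).
rewrite !ge0_integralE //; apply: ereal_sup_le => _ [h /= hf <-]; exists h => //= x.
by apply: le_trans (hf x) _; apply: lee_restrict.
Qed.

Section CubeAverages.
Variable R : realType.
Local Notation mu := (@lebesgue_measure R).

Definition cell (N i : nat) : set R := [set x | i%:R / N%:R <= x <= i.+1%:R / N%:R].

Lemma measure_cell N i : (0 < N)%N ->
  mu `[i%:R / N%:R, i.+1%:R / N%:R]%classic = (N%:R^-1)%:E /\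
  mu `[i%:R / N%:R, i.+1%:R / N%:R[%classic = (N%:R^-1)%:E.
Proof.
move=> N0; have N0' : 0 < N%:R :> R by rewrite ltr0n.
have lt : i%:R / N%:R < i.+1%:R / N%:R :> R by rewrite ltr_pM2r ?invr_gt0 // ltr_nat.
have e : ((i.+1%:R / N%:R)%:E - (i%:R / N%:R)%:E = (N%:R^-1 : R)%:E)%E.
  by rewrite -EFinB -mulrBl -natrB // subSnn mul1r.
by split; rewrite lebesgue_measure_itv /= lte_fin lt; exact: e.
Qed.

Lemma cell_sub01 N i : (i < N)%N -> cell N i `<=` `[0, 1].
Proof.
move=> iN x /andP [h1 h2]; have N0 : 0 < N%:R :> R by rewrite ltr0n; exact: leq_ltn_trans iN.
rewrite /= in_itv /=; apply/andP; split.
  by apply: le_trans h1; rewrite divr_ge0.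
by apply: le_trans h2 _; rewrite ler_pdivrMr // mul1r ler_nat.
Qed.

Lemma cell_cover N (x : R) : (0 < N)%N -> 0 <= x -> x < 1 ->
  exists2 i, (i < N)%N & i%:R / N%:R <= x < i.+1%:R / N%:R.
Proof.
move=> N0 x0 x1; have N0' : 0 < N%:R :> R by rewrite ltr0n.
have xN : 0 <= x * N%:R by rewrite mulr_ge0.
have /andP [h1 h2] := truncn_itv xN.
exists (Num.truncn (x * N%:R)).
  rewrite -(ltr_nat R); apply: le_lt_trans h1 _.
  by rewrite -[ltRHS]mul1r ltr_pM2r.
by rewrite ler_pdivrMr // h1 ltr_pdivlMr.
Qed.

Lemma integral_indic_sum N (A : nat -> set R) (c : nat -> R) :
  (forall i, measurable (A i)) -> (forall i, 0 <= c i) ->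
  (\int[mu]_(x in `[0%R, 1%R]%classic) (\sum_(i < N) (c i * \1_(A i) x)%:E) =
   \sum_(i < N) (c i)%:E * mu (A i `&` `[0%R, 1%R]%classic))%E.
Proof.
move=> mA c0; rewrite ge0_integral_sum //; last 2 first.
- move=> j; apply/measurable_EFinP; apply: (measurable_funM (f := cst (c j))) => //.
  exact: (measurable_indic (mA j)).
- by move=> j x _; rewrite lee_fin mulr_ge0.
apply: eq_bigr => i _; under eq_integral do rewrite EFinM.
rewrite ge0_integralZl ?lee_fin //.
- by rewrite integral_indic //; exact: mA.
- by apply/measurable_EFinP; exact: (measurable_indic (mA i)).
Qed.

(** Closed cells cover [0,1] including the endpoint 1; their overlaps only enlarge the majorant. *)
Lemma integral_step_ub N (h : R -> \bar R) (c : nat -> R) : (0 < N)%N ->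
  (forall x, 0 <= h x)%E -> (forall i, 0 <= c i) ->
  (forall i x, (i < N)%N -> cell N i x -> (h x <= (c i)%:E)%E) ->
  (\int[mu]_(x in `[0%R, 1%R]%classic) h x <= (N%:R^-1 * \sum_(i < N) c i)%:E)%E.
Proof.
move=> N0 h0 c0 hc.
pose A i := `[i%:R / N%:R, i.+1%:R / N%:R]%classic : set R.
have mA i : measurable (A i) by exact: measurable_itv.
have AE i x : A i x = cell N i x by rewrite /A /cell /= in_itv.
apply: (@le_trans _ _ (\int[mu]_(x in `[0%R, 1%R]%classic) (\sum_(i < N) (c i * \1_(A i) x)%:E))%E).
  apply: ge0_le_integral_nomeas => // x; rewrite /= in_itv /= => /andP [x0 x1].
  have t0 i : (0 <= (c i * \1_(A i) x)%:E)%E by rewrite lee_fin mulr_ge0.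
  have [i iN Ai] : exists2 i, (i < N)%N & cell N i x.
    have [x1'|x1'] := ltP x 1.
      by have [i iN /andP [h1 /ltW h2]] := cell_cover N0 x0 x1'; exists i => //; rewrite /cell /= h1 h2.
    exists N.-1; first by rewrite prednK.
    have -> : x = 1 by apply/eqP; rewrite eq_le x1 x1'.
    rewrite /cell /= prednK // divff ?pnatr_eq0 -?lt0n // lexx andbT.
    by rewrite ler_pdivrMr ?ltr0n // mul1r ler_nat leq_pred.
  rewrite (bigD1 (Ordinal iN)) //=.
  rewrite (le_trans (hc i x iN Ai)) // indicE mem_set ?AE // mulr1.
  by rewrite leeDl // sume_ge0.
rewrite integral_indic_sum // mulr_sumr -sumEFin; apply: lee_sum => i _.
rewrite mulrC EFinM lee_pmul ?lee_fin // -(measure_cell i N0).1.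
apply: le_measure; rewrite ?inE; last exact: subIsetl.
  by apply: measurableI; [exact: mA|exact: measurable_itv].
exact: mA.
Qed.

(** Half-open cells are disjoint, so the minorant takes a single value [c i] at each point and
    vanishes outside all cells. *)
Lemma integral_step_lb N (h : R -> \bar R) (c : nat -> R) : (0 < N)%N ->
  (forall x, 0 <= h x)%E -> (forall i, 0 <= c i) ->
  (forall i x, (i < N)%N -> cell N i x -> ((c i)%:E <= h x)%E) ->
  ((N%:R^-1 * \sum_(i < N) c i)%:E <= \int[mu]_(x in `[0%R, 1%R]%classic) h x)%E.
Proof.
move=> N0 h0 c0 hc.
pose A i := `[i%:R / N%:R, i.+1%:R / N%:R[%classic : set R.
have mA i : measurable (A i) by exact: measurable_itv.
have AE i x : A i x -> cell N i x.
  by rewrite /A /cell /= in_itv /= => /andP [-> /ltW].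
apply: (@le_trans _ _ (\int[mu]_(x in `[0%R, 1%R]%classic) (\sum_(i < N) (c i * \1_(A i) x)%:E))%E).
  rewrite integral_indic_sum // mulr_sumr -sumEFin; apply: lee_sum => i _.
  rewrite mulrC EFinM (setIidl (_ : A i `<=` _)) ?(measure_cell i N0).2 //.
  by move=> x /AE; exact: cell_sub01.
apply: ge0_le_integral_nomeas => x _; first by rewrite sume_ge0 // => i _; rewrite lee_fin mulr_ge0.
have [[i Ai]|nA] := pselect (exists i : 'I_N, A i x); last first.
  rewrite big1 ?h0 // => i _; rewrite indicE memNset ?mulr0 // => Ai.
  by apply: nA; exists i.
rewrite (bigD1 i) //= big1 ?adde0 => [|j ji].
  by rewrite indicE mem_set // mulr1; apply: hc => //; exact: AE.
rewrite indicE memNset ?mulr0 //.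
move: Ai; rewrite /A /= !in_itv /= => /andP [i1 i2] /andP [j1 j2].
have N0' : 0 < N%:R :> R by rewrite ltr0n.
have := le_lt_trans i1 j2; have := le_lt_trans j1 i2.
rewrite !ltr_pM2r ?invr_gt0 // !ltr_nat !ltnS => h1 h2.
by move/eqP: ji; apply; apply: val_inj; apply/eqP; rewrite eqn_leq h1 h2.
Qed.

(** A grid average, recursive in the same order as [cube_int] so that bounds on cells pass to the
    cube one coordinate at a time. *)
Fixpoint cube_avg (N n : nat) (g : seq nat -> R) : R :=
  if n is n'.+1 then N%:R^-1 * \sum_(i < N) cube_avg N n' (fun a => g (val i :: a))
  else g [::].

Definition in_cells N (a : seq nat) (x : seq R) :=
  size a = size x /\ forall j, (j < size a)%N -> (nth 0%N a j < N)%N /\ cell N (nth 0%N a j) (nth 0 x j).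

Lemma in_cells_cons N i t a x : (i < N)%N -> cell N i t -> in_cells N a x ->
  in_cells N (i :: a) (t :: x).
Proof.
by move=> iN it [sax ax]; split=> [|[|j]] //=; [rewrite sax | exact: ax].
Qed.

Lemma cube_avg_ge0 N n g : (forall a, 0 <= g a) -> 0 <= cube_avg N n g.
Proof.
elim: n g => [|n IH] g g0 //=; rewrite mulr_ge0 ?invr_ge0 // sumr_ge0 // => i _.
exact: IH.
Qed.

Lemma cube_int_ge0 n (f : seq R -> \bar R) : (forall x, 0 <= f x)%E -> (0 <= cube_int n f)%E.
Proof.
by elim: n f => [|n IH] f f0 //=; apply: integral_ge0 => t _; apply: IH.
Qed.

Lemma cube_int_ub N n (f : seq R -> \bar R) g : (0 < N)%N ->
  (forall x, 0 <= f x)%E -> (forall a, 0 <= g a) ->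
  (forall a x, size a = n -> in_cells N a x -> (f x <= (g a)%:E)%E) ->
  (cube_int n f <= (cube_avg N n g)%:E)%E.
Proof.
move=> N0; elim: n f g => [|n IH] f g f0 g0 fg /=; first by apply: fg.
apply: (integral_step_ub (c := fun i => cube_avg N n (fun a => g (i :: a)))) => //.
- by move=> t; apply: cube_int_ge0.
- by move=> i; apply: cube_avg_ge0.
- move=> i t iN it; apply: IH => // a x sa ax.
  by apply: fg; [rewrite /= sa | exact: in_cells_cons].
Qed.

Lemma cube_int_lb N n (f : seq R -> \bar R) g : (0 < N)%N ->
  (forall x, 0 <= f x)%E -> (forall a, 0 <= g a) ->
  (forall a x, size a = n -> in_cells N a x -> ((g a)%:E <= f x)%E) ->
  ((cube_avg N n g)%:E <= cube_int n f)%E.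
Proof.
move=> N0; elim: n f g => [|n IH] f g f0 g0 fg /=; first by apply: fg.
apply: (integral_step_lb (c := fun i => cube_avg N n (fun a => g (i :: a)))) => //.
- by move=> t; apply: cube_int_ge0.
- by move=> i; apply: cube_avg_ge0.
- move=> i t iN it; apply: IH => // a x sa ax.
  by apply: fg; [rewrite /= sa | exact: in_cells_cons].
Qed.

Lemma cube_avg_le N n g h : (forall a, size a = n -> all (fun i => i < N)%N a -> g a <= h a) ->
  cube_avg N n g <= cube_avg N n h.
Proof.
elim: n g h => [|n IH] g h gh /=; first exact: gh.
rewrite ler_wpM2l ?invr_ge0 // ler_sum // => i _; apply: IH => a sa aN.
by apply: gh => /=; rewrite ?sa // aN ltn_ord.
Qed.

Lemma cube_avgD N n g h :
  cube_avg N n (fun a => g a + h a) = cube_avg N n g + cube_avg N n h.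
Proof.
elim: n g h => [//|n IH] g h /=.
by rewrite -mulrDr -big_split /=; under eq_bigr do rewrite IH.
Qed.

Lemma cube_avgZ N n c g : cube_avg N n (fun a => c * g a) = c * cube_avg N n g.
Proof.
elim: n g => [//|n IH] g /=; under eq_bigr do rewrite IH.
by rewrite -mulr_sumr mulrCA.
Qed.

Lemma cube_avg_cst N n c : (0 < N)%N -> cube_avg N n (fun=> c) = c.
Proof.
move=> N0; elim: n => [//|n IH] /=; under eq_bigr do rewrite IH.
rewrite sumr_const card_ord -[c *+ N]mulr_natl mulrA mulVf ?mul1r //.
by rewrite pnatr_eq0 -lt0n.
Qed.

Lemma cube_avg_coord N n v h : (0 < N)%N -> (v < n)%N ->
  cube_avg N n (fun a => h (nth 0%N a v)) = N%:R^-1 * \sum_(i < N) h (val i).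
Proof.
move=> N0; elim: n v => [//|n IH] [|v] /= vn.
  by congr (_ * _); apply: eq_bigr => i _; rewrite cube_avg_cst.
under eq_bigr do rewrite IH //.
have := cube_avg_cst 1 (N%:R^-1 * \sum_(i < N) h (val i)) N0.
by rewrite /=.
Qed.

Definition natdist (i j : nat) := ((i - j) + (j - i))%N.

Lemma natdistC i j : natdist i j = natdist j i.
Proof. by rewrite /natdist addnC. Qed.

(** Each distance is realised at most twice, once on either side of [i]. *)
Lemma sum_natdist_le N i (w : nat -> R) : (i < N)%N -> (forall m, 0 <= w m) ->
  \sum_(j < N) w (natdist i j) <= 2 * \sum_(m < N) w m.
Proof.
move=> iN w0; rewrite mulr_natl mulr2n -(big_mkord xpredT (fun j => w (natdist i j))).
rewrite -(big_mkord xpredT w).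
have le_sum n1 n2 : (n1 <= n2)%N -> \sum_(0 <= m < n1) w m <= \sum_(0 <= m < n2) w m.
  by move=> n12; rewrite [leRHS](big_cat_nat (leq0n n1) n12) //= lerDl sumr_ge0.
rewrite (big_cat_nat (leq0n i.+1) iN) //=; apply: lerD.
  rewrite big_nat_rev /= add0n.
  rewrite (eq_big_nat _ _ (F2 := w)) => [|j /andP [_ ji]]; first exact: le_sum.
  by congr w; rewrite /natdist; lia.
rewrite -{1}[i.+1]add0n big_addn.
rewrite (eq_big_nat _ _ (F2 := fun j => w j.+1)) => [|j _]; last by congr w; rewrite /natdist; lia.
apply: (le_trans _ (le_sum (N - i.+1).+1 N ltac:(lia))).
by rewrite big_nat_recl //= lerDr.
Qed.

Lemma avg_le N (F : 'I_N -> R) c : (0 < N)%N -> (forall i, F i <= c) ->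
  N%:R^-1 * \sum_(i < N) F i <= c.
Proof.
move=> N0 Fc; rewrite ler_pdivrMl ?ltr0n //.
apply: (@le_trans _ _ (\sum_(i < N) c)); first exact: ler_sum.
by rewrite sumr_const card_ord mulr_natl.
Qed.

(** Here [u != v] matters: with equal coordinates only the distance zero occurs, and the oscillation
    at a single grid point need not be small. *)
Lemma cube_avg_natdist_le N n u v (w : nat -> R) : (0 < N)%N ->
  (u < n)%N -> (v < n)%N -> u != v -> (forall m, 0 <= w m) ->
  cube_avg N n (fun a => w (natdist (nth 0%N a u) (nth 0%N a v))) <=
  2 * (N%:R^-1 * \sum_(m < N) w m).
Proof.
move=> N0 + + + w0; elim: n u v => [//|n IH] [|u] [|v] //= un vn uv.
- apply: avg_le => // i; rewrite (cube_avg_coord (fun j => w (natdist i j))) //.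
  by rewrite mulrCA ler_wpM2l ?invr_ge0 // sum_natdist_le.
- apply: avg_le => // i; rewrite (cube_avg_coord (fun j => w (natdist j i))) //.
  rewrite mulrCA ler_wpM2l ?invr_ge0 //.
  have -> : \sum_(j < N) w (natdist (val j) i) = \sum_(j < N) w (natdist i j).
    by apply: eq_bigr => j _; rewrite natdistC.
  exact: sum_natdist_le.
- by apply: avg_le => // i; apply: IH.
Qed.

Lemma cube_avgE N n g :
  cube_avg N n g = (N%:R ^+ n)^-1 * \sum_(a : n.-tuple 'I_N) g (map val a).
Proof.
elim: n g => [|n IH] g /=.
  rewrite expr0 invr1 mul1r (bigD1 [tuple]) //= big1 ?addr0 // => a.
  by move=> /eqP []; apply: tuple0.
under eq_bigr do rewrite IH.
rewrite -mulr_sumr mulrA -invfM -exprS; congr (_ * _).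
rewrite pair_big /=.
rewrite [RHS](reindex (fun p : 'I_N * n.-tuple 'I_N => cons_tuple p.1 p.2)) /=.
  by apply: eq_bigr => -[i a] _.
exists (fun a : n.+1.-tuple 'I_N => (thead a, behead_tuple a)) => [[i a] _|a _] /=.
  by congr pair; apply: val_inj.
by rewrite [RHS]tuple_eta; apply: val_inj.
Qed.

(** Telescoping: the factors are exchanged one at a time while [K] bounds the others. *)
Lemma prod_diff_le (I : eqType) (s : seq I) (L U : I -> R) K : 1 <= K ->
  (forall e, 0 <= L e) -> (forall e, L e <= U e) -> (forall e, U e <= K) ->
  \prod_(e <- s) U e - \prod_(e <- s) L e <= K ^+ size s * \sum_(e <- s) (U e - L e).
Proof.
move=> K1 L0 LU UK; have U0 e : 0 <= U e by exact: le_trans (LU e).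
have K0 : 0 <= K by exact: le_trans K1.
elim: s => [|e s IH]; first by rewrite !big_nil subrr mulr0.
rewrite !big_cons /=.
have pL : \prod_(j <- s) L j <= K ^+ size s.
  elim: s {IH} => [|j s IH] /=; first by rewrite big_nil.
  rewrite big_cons exprS ler_pM ?prodr_ge0 //; exact: le_trans (UK j).
have pL0 : 0 <= \prod_(j <- s) L j by rewrite prodr_ge0.
have pD : 0 <= \prod_(j <- s) U j - \prod_(j <- s) L j.
  by rewrite subr_ge0; apply: ler_prod => j _; rewrite L0 LU.
have -> : U e * \prod_(j <- s) U j - L e * \prod_(j <- s) L j =
  U e * (\prod_(j <- s) U j - \prod_(j <- s) L j) + (U e - L e) * \prod_(j <- s) L j by ring.
rewrite [leRHS]mulrDr [leLHS]addrC; apply: lerD.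
  rewrite mulrC ler_wpM2r ?subr_ge0 //; apply: (le_trans pL).
  by rewrite exprS ler_peMl // exprn_ge0.
rewrite exprS -mulrA; apply: ler_pM => //.
Qed.

Lemma natdistE (i j : nat) : (natdist i j)%:R = `|i%:R - j%:R| :> R.
Proof.
rewrite /natdist natrD; have [ij|/ltnW ij] := leqP i j.
  rewrite (_ : (i - j = 0)%N) ?add0r ?natrB //; last by apply/eqP.
  by rewrite distrC ger0_norm // subr_ge0 ler_nat.
rewrite (_ : (j - i = 0)%N) ?addr0 ?natrB //; last by apply/eqP.
by rewrite ger0_norm // subr_ge0 ler_nat.
Qed.

(** For points in two cells whose indices differ by [m], the distance deviates from [m/n] by at most
    [1/n]. *)
Definition nearby (n m : nat) : set R :=
  [set x | 0 <= x <= 1 /\ `|x - m%:R / n%:R| <= n%:R^-1].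

Lemma nearby_grid n m : (0 < n)%N -> (m <= n)%N -> nearby n m (m%:R / n%:R).
Proof.
move=> n0 mn; rewrite /nearby /= subrr normr0 invr_ge0 ler0n divr_ge0 //.
by rewrite ler_pdivrMr ?ltr0n // mul1r ler_nat mn.
Qed.

Lemma nearby_cells N a b (x y : R) : (a < N)%N -> (b < N)%N ->
  cell N a x -> cell N b y -> nearby N (natdist a b) `|x - y|.
Proof.
move=> aN bN ax bx; have N0 : (0 < N)%N by exact: leq_ltn_trans aN.
have := cell_sub01 aN ax; have := cell_sub01 bN bx.
rewrite /= !in_itv /= => /andP [y0 y1] /andP [x0 x1].
split; first by rewrite normr_ge0 ler_norml; lra.
rewrite natdistE -[N%:R^-1 in X in `|_ - X|](@ger0_norm _ N%:R^-1) ?invr_ge0 //.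
rewrite -normrM mulrBl (le_trans (ler_dist_dist _ _)) //.
move: ax bx => /andP [a1 a2] /andP [b1 b2].
have e (i : nat) : i.+1%:R / N%:R = i%:R / N%:R + N%:R^-1 :> R.
  by rewrite -natr1 mulrDl mul1r.
rewrite e in a2; rewrite e in b2.
by rewrite ler_norml; lra.
Qed.

Lemma sum_shift_le n (G H : nat -> R) : G 0%N = 0 -> (forall i, 0 <= H i) ->
  (forall i, (i.+1 < n)%N -> G i.+1 <= H i) -> \sum_(m < n) G m <= \sum_(i < n) H i.
Proof.
case: n => [|n] G0 H0 GH; first by rewrite !big_ord0.
rewrite big_ord_recl [leRHS]big_ord_recr /= G0 add0r ler_wpDr // ler_sum // => i _.
by rewrite /bump leq0n add1n; apply: GH; rewrite ltnS.
Qed.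

(** * Average oscillation of the squared weight *)

Section Oscillation.
Variables (alpha : R -> R) (C : R).
Hypothesis alphaC : forall x : R, 0 <= x <= 1 -> `|alpha x| <= C.
Hypothesis alphaR : riemann_integrable01 alpha.

Let C0 : 0 <= C.
Proof. by apply: le_trans (alphaC (_ : 0 <= 0 <= 1)) => //; rewrite lexx ler01. Qed.

Let beta x := alpha x ^+ 2.

(** In each cell the tag with the larger value of [alpha] goes into one Riemann sum and the other
    tag into a second. Both sums are within [e / 2] of the integral, and their difference is the sum
    of the absolute differences. *)
Lemma osc_tags (e : R) : 0 < e -> exists n0, forall n, (n0 <= n)%N -> (0 < n)%N ->
  forall xi eta : nat -> R,
  (forall i, (i < n)%N -> cell n i (xi i) /\ cell n i (eta i)) ->
  n%:R^-1 * \sum_(i < n) `|alpha (xi i) - alpha (eta i)| < e.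
Proof.
move=> e0; have [I HI] := alphaR.
have e20 : 0 < e / 2 by rewrite divr_gt0.
have [dlt d0 Hd] := HI _ e20.
exists (Num.truncn dlt^-1).+1 => n nn0 n0 xi eta Hc.
have n0' : 0 < n%:R :> R by rewrite ltr0n.
have small : n%:R^-1 < dlt.
  rewrite -[dlt]invrK ltf_pV2 ?posrE ?invr_gt0 //.
  have di : 0 <= dlt^-1 by rewrite invr_ge0 ltW.
  have /andP [_ h] := truncn_itv di.
  by apply: lt_le_trans h _; rewrite ler_nat.
pose t (i : nat) : R := i%:R / n%:R.
have tE i : t i.+1 - t i = n%:R^-1 by rewrite /t -mulrBl -natrB // subSnn mul1r.
have t0 : t 0%N = 0 by rewrite /t mul0r.
have tn : t n = 1 by rewrite /t divff // gt_eqF.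
have HT tag : (forall i, (i < n)%N -> cell n i (tag i)) ->
    `| \sum_(i < n) alpha (tag i) * n%:R^-1 - I | < e / 2.
  move=> Htag; have := Hd n t tag t0 tn.
  under eq_bigr do rewrite tE; apply=> i iN; split.
  - by rewrite -subr_ge0 tE invr_ge0.
  - by rewrite tE.
  - exact: Htag.
pose hi i := if alpha (eta i) <= alpha (xi i) then xi i else eta i.
pose lo i := if alpha (eta i) <= alpha (xi i) then eta i else xi i.
have Hhi : forall i, (i < n)%N -> cell n i (hi i).
  by move=> i iN; rewrite /hi; case: ifP => _; case: (Hc i iN).
have Hlo : forall i, (i < n)%N -> cell n i (lo i).
  by move=> i iN; rewrite /lo; case: ifP => _; case: (Hc i iN).
have -> : n%:R^-1 * \sum_(i < n) `|alpha (xi i) - alpha (eta i)| =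
    (\sum_(i < n) alpha (hi i) * n%:R^-1 - I) - (\sum_(i < n) alpha (lo i) * n%:R^-1 - I).
  rewrite opprB addrA subrK -sumrB mulr_sumr; apply: eq_bigr => i _.
  rewrite -mulrBl mulrC; congr (_ * _); rewrite /hi /lo.
  case: leP => [h|h]; first by rewrite ger0_norm // subr_ge0.
  by rewrite ltr0_norm ?opprB // subr_lt0.
have := HT _ Hhi; have := HT _ Hlo; rewrite !ltr_norml; lra.
Qed.

(** The window around [m/n] meets two cells. The maximum and the minimum of [z m] and [m/n] are tags
    in the right and the left cell, and one of the two resulting terms vanishes; this is the origin
    of the factor 2. *)
Lemma nearby_tags (e : R) : 0 < e -> exists n0, forall n, (n0 <= n)%N -> (0 < n)%N ->
  forall z : nat -> R, (forall m, (m < n)%N -> nearby n m (z m)) ->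
  n%:R^-1 * \sum_(m < n) `|alpha (z m) - alpha (m%:R / n%:R)| < 2 * e.
Proof.
move=> e0; have [n0 Hn] := osc_tags e0; exists n0 => n nn0 n_gt0 z Hz.
have n0' : 0 < n%:R :> R by rewrite ltr0n.
have st (i : nat) : i.+1%:R / n%:R = i%:R / n%:R + n%:R^-1 :> R.
  by rewrite -natr1 mulrDl mul1r.
pose q (m : nat) : R := m%:R / n%:R.
have q_cell i : cell n i (q i) by rewrite /cell /q /= st lexx lerDl invr_ge0 ler0n.
have q_cellS i : cell n i (q i.+1) by rewrite /cell /q /= st lexx lerDl invr_ge0 ler0n.
pose zr m := Num.max (z m) (q m).
pose zl m := Num.min (z m) (q m).
have zE m : `|alpha (z m) - alpha (q m)| =
    `|alpha (zr m) - alpha (q m)| + `|alpha (zl m) - alpha (q m)|.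
  by rewrite /zr /zl; case: leP => _; rewrite subrr normr0 ?addr0 ?add0r.
have zr_cell m : (m < n)%N -> cell n m (zr m).
  move=> mn; have [/andP [z0 z1]] := Hz m mn; rewrite /cell /= st ler_norml => /andP [h1 h2].
  have i0 : 0 < n%:R^-1 :> R by rewrite invr_gt0.
  rewrite /zr /q le_max lexx orbT /= ge_max; lra.
have zl_cell m : (m.+1 < n)%N -> cell n m (zl m.+1).
  move=> mn; have [/andP [z0 z1]] := Hz m.+1 mn; rewrite /cell /= ler_norml st => /andP [h1 h2].
  have i0 : 0 < n%:R^-1 :> R by rewrite invr_gt0.
  rewrite /zl /q ge_min st lexx orbT andbT le_min; lra.
under eq_bigr do rewrite zE.
rewrite big_split mulrDr mulr_natl mulr2n; apply: ltrD.
  by apply: Hn => // i iN; split; [exact: zr_cell|exact: q_cell].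
(* The left tags are shifted by one index, as [zl m] lies in cell [m - 1]. In the last cell the grid
   point serves as both tags and contributes zero. *)
pose xi i := if (i.+1 < n)%N then zl i.+1 else q i.+1.
apply: le_lt_trans (Hn n nn0 n_gt0 xi (fun i => q i.+1) _); last first.
  by move=> i iN; split=> //; rewrite /xi; case: ifP => // /zl_cell.
rewrite ler_wpM2l ?invr_ge0 //.
apply: (sum_shift_le (G := fun m => `|alpha (zl m) - alpha (q m)|)
  (H := fun i => `|alpha (xi i) - alpha (q i.+1)|)) => //.
  have [/andP [z0 _] _] := Hz 0%N n_gt0.
  have -> : zl 0%N = q 0%N by rewrite /zl /q mul0r min_r.
  by rewrite subrr normr0.
by move=> i iN; rewrite /xi iN.
Qed.

(* [minn] keeps the set nonempty, so that [sup] and [inf] have no junk value. *)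
Definition beta_sup n m := sup [set beta x | x in nearby n (minn m n)].
Definition beta_inf n m := inf [set beta x | x in nearby n (minn m n)].

Let betaC x : 0 <= x <= 1 -> beta x <= C ^+ 2.
Proof.
by move=> /alphaC h; rewrite /beta -real_normK ?num_real // lerXn2r ?nnegrE.
Qed.

Let has_sup_beta n m : (0 < n)%N -> has_sup [set beta x | x in nearby n (minn m n)].
Proof.
move=> n0; split; last by exists (C ^+ 2) => _ [x [x01 _] <-]; exact: betaC.
eexists; exists ((minn m n)%:R / n%:R); last by [].
by apply: nearby_grid => //; rewrite geq_minr.
Qed.

Let has_inf_beta n m : (0 < n)%N -> has_inf [set beta x | x in nearby n (minn m n)].
Proof.
move=> n0; split; last by exists 0 => _ [x _ <-]; rewrite /beta sqr_ge0.
eexists; exists ((minn m n)%:R / n%:R); last by [].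
by apply: nearby_grid => //; rewrite geq_minr.
Qed.

Lemma beta_bounds n m x : (0 < n)%N -> (m <= n)%N -> nearby n m x ->
  beta_inf n m <= beta x <= beta_sup n m.
Proof.
move=> n0 mn hx; apply/andP; split.
  by apply: ge_inf; [case: (has_inf_beta m n0) | exists x => //; rewrite (minn_idPl mn)].
by apply: ub_le_sup; [case: (has_sup_beta m n0) | exists x => //; rewrite (minn_idPl mn)].
Qed.

Lemma beta_inf_ge0 n m : (0 < n)%N -> 0 <= beta_inf n m.
Proof.
move=> n0; apply: lb_le_inf; first by case: (has_inf_beta m n0).
by move=> _ [x _ <-]; rewrite /beta sqr_ge0.
Qed.

Lemma beta_inf_le_sup n m : (0 < n)%N -> beta_inf n m <= beta_sup n m.
Proof.
move=> n0; have mn : (minn m n <= n)%N by rewrite geq_minr.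
have /andP [h1 h2] := beta_bounds n0 mn (nearby_grid n0 mn).
by move: (le_trans h1 h2); rewrite /beta_inf /beta_sup (minn_idPl mn).
Qed.

Lemma beta_sup_le n m : (0 < n)%N -> beta_sup n m <= C ^+ 2 + 1.
Proof.
move=> n0; apply: (@le_trans _ _ (C ^+ 2)); last by rewrite lerDl.
apply: ge_sup; first by case: (has_sup_beta m n0).
by move=> _ [x [x01 _] <-]; exact: betaC.
Qed.

(** Near-extremal points stand in for the supremum and the infimum, which need not be attained. The
    estimate [|a^2 - b^2| <= 2C|a - b|] then leads back to [alpha], with its value at the grid point
    as intermediary. *)
Lemma avg_oscillation (e : R) : 0 < e -> exists n0, forall n, (n0 <= n)%N -> (0 < n)%N ->
  n%:R^-1 * \sum_(m < n) (beta_sup n m - beta_inf n m) < e.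
Proof.
move=> e0.
(* The near-extremal points use up [e / 4] each. The remaining term [4 * C * e1] stays below
   [e / 2]; the summand 1 keeps the divisor positive when [C = 0]. *)
pose e1 := e / (2 * (4 * C + 1)).
have C4 : 0 < 4 * C + 1 by rewrite ltr_wpDl // mulr_ge0.
have e10 : 0 < e1 by rewrite divr_gt0 // mulr_gt0.
have [n0 Hn] := nearby_tags (divr_gt0 e10 (ltr0n R 2)); exists n0 => n nn0 n_gt0.
have e40 : 0 < e / 4 by rewrite divr_gt0.
have [x Hx] : {x : nat -> R & forall m, nearby n (minn m n) (x m) /\ beta_sup n m - e / 4 < beta (x m)}.
  apply: (@choice _ _ (fun m x => nearby n (minn m n) x /\ beta_sup n m - e / 4 < beta x)) => m.
  have [_ [x hx <-] h] := sup_adherent e40 (has_sup_beta m n_gt0).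
  by exists x.
have [y Hy] : {y : nat -> R & forall m, nearby n (minn m n) (y m) /\ beta (y m) < beta_inf n m + e / 4}.
  apply: (@choice _ _ (fun m x => nearby n (minn m n) x /\ beta x < beta_inf n m + e / 4)) => m.
  have [_ [x' hx <-] h] := inf_adherent e40 (has_inf_beta m n_gt0).
  by exists x'.
have Hx' m : (m < n)%N -> nearby n m (x m).
  by move=> mn; have [+ _] := Hx m; rewrite (minn_idPl (ltnW mn)).
have Hy' m : (m < n)%N -> nearby n m (y m).
  by move=> mn; have [+ _] := Hy m; rewrite (minn_idPl (ltnW mn)).
have Sx := Hn n nn0 n_gt0 x Hx'; have Sy := Hn n nn0 n_gt0 y Hy'.
pose ax m := `|alpha (x m) - alpha (m%:R / n%:R)|.
pose ay m := `|alpha (y m) - alpha (m%:R / n%:R)|.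
have W m : (m < n)%N -> beta_sup n m - beta_inf n m <= 2 * C * (ax m + ay m) + e / 2.
  move=> mn; have [_ h1] := Hx m; have [_ h2] := Hy m.
  have le1 : beta (x m) - beta (y m) <= 2 * C * (ax m + ay m).
    have [x01 _] := Hx' m mn; have [y01 _] := Hy' m mn.
    rewrite /beta subr_sqr mulrC (le_trans (ler_norm _)) // normrM ler_pM //.
      by rewrite (le_trans (ler_normD _ _)) // mulr_natl mulr2n lerD // alphaC.
    by rewrite /ax /ay [`|alpha (y m) - _|]distrC (le_trans _ (ler_normD _ _)) // addrA subrK.
  lra.
apply: (@le_lt_trans _ _ (n%:R^-1 * \sum_(m < n) (2 * C * (ax m + ay m) + e / 2))).
  by rewrite ler_wpM2l ?invr_ge0 //; apply: ler_sum => m _; exact: W.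
rewrite big_split /= sumr_const card_ord -mulr_sumr big_split /=.
rewrite -[(e / 2) *+ n]mulr_natl mulrDr mulKf; last by rewrite pnatr_eq0 -lt0n.
rewrite mulrCA mulrDr.
set sx := n%:R^-1 * \sum_(i < n) ax i; set sy := n%:R^-1 * \sum_(i < n) ay i.
have {}Sx : sx < e1 by move: Sx; rewrite mulrCA divff ?mulr1 // pnatr_eq0.
have {}Sy : sy < e1 by move: Sy; rewrite mulrCA divff ?mulr1 // pnatr_eq0.
have le1 : 2 * C * (sx + sy) <= 2 * C * (2 * e1).
  by rewrite ler_wpM2l ?mulr_ge0 //; lra.
have : e / 2 = e1 * (4 * C + 1) by rewrite /e1; field; rewrite gt_eqF.
lra.
Qed.

End Oscillation.

Lemma cube_avg_sum (I : Type) N n (s : seq I) (g : I -> seq nat -> R) :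
  cube_avg N n (fun a => \sum_(e <- s) g e a) = \sum_(e <- s) cube_avg N n (g e).
Proof.
elim: n g => [//|n IH] g /=; under eq_bigr do rewrite IH.
by rewrite exchange_big mulr_sumr.
Qed.

Lemma riemann_cube (alpha : R -> R) (C : R) n (E : seq (nat * nat)) :
  (forall x : R, 0 <= x <= 1 -> `|alpha x| <= C) -> riemann_integrable01 alpha ->
  (forall e, e \in E -> [/\ (e.1 < n)%N, (e.2 < n)%N & e.1 != e.2]) ->
  (fun N : nat => (N%:R ^+ n)^-1 * \sum_(a : n.-tuple 'I_N)
     \prod_(e <- E) alpha (`|(nth 0%N (map val a) e.1)%:R - (nth 0%N (map val a) e.2)%:R| / N%:R) ^+ 2)
  @ \oo --> fine (cube_int n (fun x =>
     (\prod_(e <- E) alpha `|nth 0 x e.1 - nth 0 x e.2| ^+ 2)%:E)).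
Proof.
move=> aC aR HE; set J := cube_int _ _.
have C0 : 0 <= C by apply: le_trans (aC 0 _) => //; rewrite lexx ler01.
pose K := C ^+ 2 + 1; have K1 : 1 <= K by rewrite lerDr sqr_ge0.
(* [M] exceeds the constant that multiplies the average oscillation, a factor 2 per edge coming from
   the two signs of a distance. *)
pose M := K ^+ size E * ((size E)%:R * 2) + 1.
have M0 : 0 < M.
  by rewrite ltr_wpDl // !mulr_ge0 // exprn_ge0 // (le_trans _ K1).
apply/cvgrPdist_lt => eps eps0.
have [n0 Hn0] := avg_oscillation aC aR (divr_gt0 eps0 M0).
exists (maxn n0 1) => // N /=; rewrite geq_max => /andP [n0N N0].
have osc := Hn0 N n0N N0.
rewrite -(cube_avgE N n (fun a => \prod_(e <- E)
  alpha (`|(nth 0%N a e.1)%:R - (nth 0%N a e.2)%:R| / N%:R) ^+ 2)).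
set S := cube_avg _ _ _.
pose lo a := \prod_(e <- E) beta_inf alpha N (natdist (nth 0%N a e.1) (nth 0%N a e.2)).
pose up a := \prod_(e <- E) beta_sup alpha N (natdist (nth 0%N a e.1) (nth 0%N a e.2)).
have inf0 m := beta_inf_ge0 alpha m N0.
have infsup m := beta_inf_le_sup aC m N0.
have sup0 m : 0 <= beta_sup alpha N m := le_trans (inf0 m) (infsup m).
have lo0 a : 0 <= lo a by rewrite prodr_ge0.
have up0 a : 0 <= up a by rewrite prodr_ge0.
have dN a b : (a < N)%N -> (b < N)%N -> (natdist a b <= N)%N by rewrite /natdist; lia.
have f0 x : (0 <= (\prod_(e <- E) alpha `|nth 0 x e.1 - nth 0 x e.2| ^+ 2)%:E)%E.
  by rewrite lee_fin prodr_ge0 // => e _; rewrite sqr_ge0.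
have fb a x : size a = n -> in_cells N a x ->
    lo a <= \prod_(e <- E) alpha `|nth 0 x e.1 - nth 0 x e.2| ^+ 2 <= up a.
  move=> sa [sax ax]; rewrite /lo /up big_seq [X in _ <= X <= _]big_seq [X in _ <= _ <= X]big_seq.
  have bd e : e \in E -> beta_inf alpha N (natdist (nth 0%N a e.1) (nth 0%N a e.2)) <=
      alpha `|nth 0 x e.1 - nth 0 x e.2| ^+ 2 <=
      beta_sup alpha N (natdist (nth 0%N a e.1) (nth 0%N a e.2)).
    move=> /HE [e1 e2 _]; rewrite -sa in e1 e2.
    have [a1 x1] := ax _ e1; have [a2 x2] := ax _ e2.
    by apply: (beta_bounds aC N0); [exact: dN|exact: nearby_cells].
  apply/andP; split; apply: ler_prod => e /bd /andP [h1 h2].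
    by rewrite inf0 h1.
  by rewrite sqr_ge0 h2.
have JU : (J <= (cube_avg N n up)%:E)%E.
  by apply: cube_int_ub => // a x sa ax; rewrite lee_fin; case/andP: (fb a x sa ax).
have JL : ((cube_avg N n lo)%:E <= J)%E.
  by apply: cube_int_lb => // a x sa ax; rewrite lee_fin; case/andP: (fb a x sa ax).
have Jfin : J \is a fin_num.
  by rewrite fin_numElt (lt_le_trans _ JL) ?ltNyr // (le_lt_trans JU) ?ltry.
rewrite -(fineK Jfin) !lee_fin in JU JL.
(* Grid points lie in their own cells, so the Riemann sum obeys the same two bounds as the
   integral. *)
have cell_grid a : size a = n -> all (fun i => (i < N)%N) a ->
    in_cells N a [seq i%:R / N%:R | i <- a].
  move=> sa /all_nthP aN; split; first by rewrite size_map.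
  move=> j hj; split; first exact: aN.
  by rewrite (nth_map 0%N) // /cell /= lexx ler_pM2r ?invr_gt0 ?ltr0n // ler_nat leqnSn.
have fE a : size a = n -> \prod_(e <- E) alpha `|nth 0 [seq i%:R / N%:R | i <- a] e.1 -
      nth 0 [seq i%:R / N%:R | i <- a] e.2| ^+ 2 =
    \prod_(e <- E) alpha (`|(nth 0%N a e.1)%:R - (nth 0%N a e.2)%:R| / N%:R) ^+ 2.
  move=> sa; apply: eq_big_seq => e /HE [e1 e2 _].
  rewrite !(nth_map 0%N) ?sa // -mulrBl normrM [`|N%:R^-1|]ger0_norm ?invr_ge0 //.
have SU : S <= cube_avg N n up.
  apply: cube_avg_le => a sa aN; rewrite -fE //.
  by have /andP [] := fb a _ sa (cell_grid a sa aN).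
have SL : cube_avg N n lo <= S.
  apply: cube_avg_le => a sa aN; rewrite -fE //.
  by have /andP [] := fb a _ sa (cell_grid a sa aN).
have UL : cube_avg N n up - cube_avg N n lo < eps.
  rewrite -[X in _ - X]mul1r -mulN1r mulrA mulr1.
  rewrite -cube_avgZ -cube_avgD.
  pose w m := beta_sup alpha N m - beta_inf alpha N m.
  have w0 m : 0 <= w m by rewrite subr_ge0.
  apply: (@le_lt_trans _ _ (cube_avg N n (fun a => K ^+ size E *
      \sum_(e <- E) w (natdist (nth 0%N a e.1) (nth 0%N a e.2))))).
    apply: cube_avg_le => a _ _; rewrite mulN1r; apply: prod_diff_le => //.
    by move=> e; exact: beta_sup_le.
  rewrite cube_avgZ cube_avg_sum.
  apply: (@le_lt_trans _ _ (K ^+ size E * ((size E)%:R * (2 * (eps / M))))).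
    rewrite ler_wpM2l ?exprn_ge0 ?(le_trans _ K1) // big_seq.
    apply: (@le_trans _ _ (\sum_(e <- E | e \in E) (2 * (eps / M)))).
      apply: ler_sum => e /HE [e1 e2 ne].
      apply: (le_trans (cube_avg_natdist_le N0 e1 e2 ne w0)).
      by rewrite ler_wpM2l // ltW.
    by rewrite -big_seq big_const_seq count_predT iter_addr addr0 -[leLHS]mulr_natl lexx.
  have eq (x y z t u : R) : x * (y * (z * (t * u))) = t * (x * (y * z) * u) by ring.
  rewrite eq gtr_pMr //.
  by rewrite ltr_pdivrMr // mul1r /M ltrDl.
rewrite ltr_norml; lra.
Qed.

End CubeAverages.

(** * Independence and mixed moments *)

Section Moments.
Context (R : realType) (d : measure_display) (T : measurableType d) (P : probability T R).
Implicit Types (Z Y : T -> R).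

Definition Ex Z : R := fine (\int[P]_w (Z w)%:E).

(** A class closed under products, sums and domination, on which [Ex] is linear and its [fine] hides
    no infinite value. *)
Definition all_moments Z : Prop := measurable_fun setT Z /\
  forall n, (\int[P]_w (`|Z w| ^+ n)%:E < +oo)%E.

Lemma all_moments_le Z Y : measurable_fun setT Z -> (forall w, `|Z w| <= `|Y w|) ->
  all_moments Y -> all_moments Z.
Proof.
move=> mZ ZY [mY hY]; split=> // n; apply: le_lt_trans (hY n).
apply: ge0_le_integral_nomeas => w _; first by rewrite lee_fin exprn_ge0.
by rewrite lee_fin lerXn2r ?nnegrE.
Qed.

Lemma all_moments_integrable Z : all_moments Z -> P.-integrable setT (fun w => (Z w)%:E).
Proof.
move=> [mZ /(_ 1%N) h]; apply/integrableP; split; first exact/measurable_EFinP.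
by move: h; under eq_integral do rewrite expr1.
Qed.

Lemma all_moments_fin Z : all_moments Z -> (\int[P]_w (Z w)%:E)%E \is a fin_num.
Proof. by move=> /all_moments_integrable; exact: integrable_fin_num. Qed.

Let int_cst (c : R) : (\int[P]_w c%:E = c%:E)%E.
Proof. by rewrite -[RHS]mule1 -(@probability_setT _ _ _ P); exact: integral_cst. Qed.

Lemma all_moments_bounded Z (c : R) : measurable_fun setT Z -> (forall w, `|Z w| <= c) ->
  all_moments Z.
Proof.
move=> mZ Zc; apply: (@all_moments_le _ (cst c)) => //.
  by move=> w; rewrite /= (le_trans (Zc w)) // ler_norm.
split=> [|n]; first exact: measurable_cst.
by rewrite /= int_cst ltry.
Qed.

Lemma all_momentsM Z Y : all_moments Z -> all_moments Y -> all_moments (fun w => Z w * Y w).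
Proof.
move=> [mZ hZ] [mY hY]; split=> [|n]; first exact: measurable_funM.
have mX (V : T -> R) k : measurable_fun setT V -> measurable_fun setT (fun w => (`|V w| ^+ k)%:E).
  by move=> mV; apply/measurable_EFinP; apply: measurable_funX; exact: measurableT_comp.
apply: (@le_lt_trans _ _ (\int[P]_w ((`|Z w| ^+ (n * 2))%:E + (`|Y w| ^+ (n * 2))%:E))%E).
  apply: ge0_le_integral_nomeas => w _; first by rewrite lee_fin exprn_ge0.
  rewrite -EFinD lee_fin normrM exprMn !exprM.
  have : 0 <= (`|Z w| ^+ n - `|Y w| ^+ n) ^+ 2 by rewrite sqr_ge0.
  have : 0 <= `|Z w| ^+ n * `|Y w| ^+ n by rewrite mulr_ge0 ?exprn_ge0.
  nra.
by rewrite ge0_integralD //; [exact: lte_add_pinfty | exact: mX | exact: mX].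
Qed.

Lemma all_moments_cst (c : R) : all_moments (fun=> c).
Proof. by apply: (@all_moments_bounded _ `|c|); [exact: measurable_cst|]. Qed.

Lemma all_moments_prod (I : Type) (s : seq I) (Q : pred I) (F : I -> T -> R) :
  (forall i, all_moments (F i)) -> all_moments (fun w => \prod_(i <- s | Q i) F i w).
Proof.
move=> hF; elim: s => [|i s IH].
  rewrite (_ : (fun w => _) = fun=> 1); first exact: all_moments_cst.
  by apply/funext => w; rewrite big_nil.
rewrite (_ : (fun w => _) = fun w => (if Q i then F i w else 1) * \prod_(j <- s | Q j) F j w).
  by apply: all_momentsM => //; case: (Q i) => //; exact: all_moments_cst.
by apply/funext => w; rewrite big_cons; case: ifP; rewrite ?mul1r.
Qed.

Lemma all_momentsX Z n : all_moments Z -> all_moments (fun w => Z w ^+ n).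
Proof.
move=> hZ; elim: n => [|n IH]; first exact: all_moments_cst.
rewrite (_ : (fun w => _) = fun w => Z w * Z w ^+ n); first exact: all_momentsM.
by apply/funext => w; rewrite exprS.
Qed.

Lemma all_moments_indic (X : {RV P >-> R}) (B : set R) : measurable B ->
  all_moments (fun w => \1_B (X w)).
Proof.
move=> mB; apply: (@all_moments_bounded _ 1) => [|w].
  by apply: measurableT_comp => //; exact: measurable_indic.
by rewrite indicE; case: (_ \in _); rewrite ?normr1 ?normr0.
Qed.

Lemma ExZ (c : R) Z : all_moments Z -> Ex (fun w => c * Z w) = c * Ex Z.
Proof.
move=> hZ; rewrite /Ex; under eq_integral do rewrite EFinM.
by rewrite integralZl ?fineM ?all_moments_fin //; exact (all_moments_integrable hZ).
Qed.

Lemma ExD Z Y : all_moments Z -> all_moments Y ->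
  Ex (fun w => Z w + Y w) = Ex Z + Ex Y.
Proof.
move=> hZ hY; rewrite /Ex; under eq_integral do rewrite EFinD.
rewrite (integralD measurableT (all_moments_integrable hZ) (all_moments_integrable hY)).
by rewrite fineD //; [exact: (all_moments_fin hZ)|exact: (all_moments_fin hY)].
Qed.

Lemma Ex_cst (c : R) : Ex (fun=> c) = c.
Proof. by rewrite /Ex int_cst. Qed.

(** Sums are reduced to products by [|Z + Y| <= (1 + |Z|)(1 + |Y|)]; powers of [1 + |V|] are bounded
    separately for [|V| < 1] and [|V| >= 1]. *)
Lemma all_momentsD Z Y : all_moments Z -> all_moments Y -> all_moments (fun w => Z w + Y w).
Proof.
move=> hZ hY.
have hn V : all_moments V -> all_moments (fun w => `|V w|).
  move=> hV; apply: (all_moments_le _ _ hV); last by move=> w; rewrite normr_id.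
  by apply: measurableT_comp => //; case: hV.
have m1 : all_moments (fun w => (1 + `|Z w|) * (1 + `|Y w|)).
  have h1 V : all_moments V -> all_moments (fun w => 1 + `|V w|).
    move=> hV; split; first by apply: measurable_funD => //; case: (hn V hV).
    move=> n; apply: (@le_lt_trans _ _ (\int[P]_w (2 ^+ n + 2 ^+ n * `|V w| ^+ n)%:E)%E).
      apply: ge0_le_integral_nomeas => w _; rewrite lee_fin ?exprn_ge0 //.
      rewrite ger0_norm ?addr_ge0 //.
      have [h|h] := leP 1 `|V w|.
        apply: (@le_trans _ _ ((2 * `|V w|) ^+ n)); last by rewrite exprMn lerDr exprn_ge0.
        by rewrite lerXn2r ?nnegrE ?addr_ge0 ?mulr_ge0 // mulr_natl mulr2n lerD2r.
      apply: (@le_trans _ _ (2 ^+ n)); last by rewrite lerDl mulr_ge0 ?exprn_ge0.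
      by rewrite lerXn2r ?nnegrE ?addr_ge0 // (_ : 2 = 1 + 1) // lerD2l ltW.
    have hVn : all_moments (fun w => 2 ^+ n * `|V w| ^+ n).
      by apply: all_momentsM; [exact: all_moments_cst | apply: all_momentsX; exact: hn].
    under eq_integral do rewrite EFinD.
    rewrite integralD //; last 2 first.
    - exact (all_moments_integrable (all_moments_cst _)).
    - exact (all_moments_integrable hVn).
    rewrite int_cst.
    apply: lte_add_pinfty; first exact: ltry.
    by have := all_moments_fin hVn; rewrite fin_numElt => /andP [].
  by apply: all_momentsM; exact: h1.
apply: (all_moments_le _ _ m1); first by apply: measurable_funD; [case: hZ | case: hY].
move=> w; rewrite (ger0_norm (_ : 0 <= (1 + _) * _)) ?mulr_ge0 ?addr_ge0 //.
apply: (le_trans (ler_normD _ _)).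
have : 0 <= `|Z w| * `|Y w| by rewrite mulr_ge0.
nra.
Qed.

Lemma all_moments_sum (I : Type) (s : seq I) (F : I -> T -> R) :
  (forall i, all_moments (F i)) -> all_moments (fun w => \sum_(i <- s) F i w).
Proof.
move=> hF; elim: s => [|i s IH].
  rewrite (_ : (fun w => _) = fun=> 0); first exact: all_moments_cst.
  by apply/funext => w; rewrite big_nil.
rewrite (_ : (fun w => _) = fun w => F i w + \sum_(j <- s) F j w); first exact: all_momentsD.
by apply/funext => w; rewrite big_cons.
Qed.

Lemma Ex_sum (I : Type) (s : seq I) (F : I -> T -> R) :
  (forall i, all_moments (F i)) ->
  Ex (fun w => \sum_(i <- s) F i w) = \sum_(i <- s) Ex (F i).
Proof.
move=> hF; elim: s => [|i s IH].
  rewrite (_ : (fun w => _) = fun=> 0) ?Ex_cst ?big_nil //.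
  by apply/funext => w; rewrite big_nil.
rewrite (_ : (fun w => _) = fun w => F i w + \sum_(j <- s) F j w); last first.
  by apply/funext => w; rewrite big_cons.
by rewrite ExD ?IH ?big_cons //; exact: all_moments_sum.
Qed.

(** * From indicator test functions to powers *)

Section TestFunctions.
Import HBNNSimple.
Variables (X : {RV P >-> R}).
Hypothesis hX : all_moments X.

Let values (h : {nnsfun R >-> R}) : seq R := finmap.enum_fset (fset_set (range h)).

Let Ex_sfun Y (h : {nnsfun R >-> R}) : all_moments Y ->
  Ex (fun w => h (X w) * Y w) =
  \sum_(i < size (values h)) (values h)`_i *
     Ex (fun w => \1_(h @^-1` [set (values h)`_i]) (X w) * Y w).
Proof.
move=> hY; set s := values h.
have hm i : all_moments (fun w => \1_(h @^-1` [set s`_i]) (X w) * Y w).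
  by apply: all_momentsM => //; apply: all_moments_indic.
rewrite (_ : (fun w => _) = fun w => \sum_(i < size s) s`_i * (\1_(h @^-1` [set s`_i]) (X w) * Y w)).
  rewrite Ex_sum => [|i]; first by apply: eq_bigr => i _; rewrite ExZ.
  by apply: all_momentsM => //; exact: all_moments_cst.
apply/funext => w; rewrite fimfunEord mulr_suml.
by apply: eq_bigr => i _; rewrite mulrA.
Qed.

(** Dominated convergence: the simple approximations stay below [f], so [|f(X) Y|] is an integrable
    majorant. *)
Lemma Ex_approx (f : R -> R) (mf : measurable_fun setT (EFin \o f)) Y :
  (forall x, 0 <= f x) -> all_moments (fun w => f (X w)) -> all_moments Y ->
  (fun n => Ex (fun w => nnsfun_approx measurableT mf n (X w) * Y w)) @ \oo -->
    Ex (fun w => f (X w) * Y w).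
Proof.
move=> f0 hf hY; set h := nnsfun_approx measurableT mf.
have f0' x : [set: R] x -> (0 <= (EFin \o f) x)%E by rewrite lee_fin.
have hn n x : h n x <= f x.
  by rewrite -lee_fin /h nnsfun_approxE; apply: (le_approx (D := setT) (f := EFin \o f)).
have hc x : h n x @[n --> \oo] --> f x.
  exact: (fine_cvg (cvg_nnsfun_approx measurableT mf f0' (I : setT x))).
have hfY := all_momentsM hf hY.
have hnY n : all_moments (fun w => h n (X w) * Y w).
  apply: all_momentsM => //; apply: (all_moments_le _ _ hf).
    by apply: measurableT_comp.
  by move=> w; rewrite !ger0_norm.
apply: (@fine_cvg _ _ _ _ (fun n => \int[P]_w (h n (X w) * Y w)%:E)%E).
rewrite fineK; last exact: all_moments_fin.
have [|||||_ _ //] := @dominated_convergence _ _ _ P setT measurableT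
  (fun n w => (h n (X w) * Y w)%:E) (fun w => (f (X w) * Y w)%:E)
  (fun w => `|(f (X w) * Y w)%:E|%E).
- by move=> n; apply/measurable_EFinP; case: (hnY n).
- by apply/measurable_EFinP; case: hfY.
- apply: aeW => w _; apply: cvg_EFin; first exact: nearW.
  by apply: cvgMr_tmp; exact: hc.
- apply: integrable_abse; exact: (all_moments_integrable hfY).
- apply: aeW => w n _; rewrite lee_fin !normrM ler_wpM2r // !ger0_norm //.
Qed.

Variables (G H : T -> R) (K : R).
Hypotheses (hG : all_moments G) (hH : all_moments H).
Hypothesis GHK : forall B : set R, measurable B ->
  Ex (fun w => \1_B (X w) * G w) = Ex (fun w => \1_B (X w) * H w) * K.

Let Ex_test_ge0 (f : R -> R) : measurable_fun setT f -> (forall x, 0 <= f x) ->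
  all_moments (fun w => f (X w)) ->
  Ex (fun w => f (X w) * G w) = Ex (fun w => f (X w) * H w) * K.
Proof.
move=> /measurable_EFinP mf f0 hf.
have cG := Ex_approx mf f0 hf hG.
have cH : (fun n => Ex (fun w => nnsfun_approx measurableT mf n (X w) * H w) * K) @ \oo -->
    Ex (fun w => f (X w) * H w) * K.
  by apply: cvgMr_tmp; exact: Ex_approx.
apply: (cvg_unique _ cG); first exact: norm_hausdorff.
rewrite (_ : (fun n => _) = fun n => Ex (fun w => nnsfun_approx measurableT mf n (X w) * H w) * K) //.
apply/funext => n; rewrite !Ex_sfun // mulr_suml; apply: eq_bigr => i _.
by rewrite GHK // mulrA.
Qed.

(** The power may be negative, so it is split into its positive and negative parts, each a limit of
    simple functions. *)
Lemma Ex_test_pow m : Ex (fun w => X w ^+ m * G w) = Ex (fun w => X w ^+ m * H w) * K.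
Proof.
pose f1 (x : R) := (`|x ^+ m| + x ^+ m) / 2.
pose f2 (x : R) := (`|x ^+ m| - x ^+ m) / 2.
have mx : measurable_fun [set: R] (fun x : R => x ^+ m) by exact: measurable_funX.
have mn : measurable_fun [set: R] (fun x : R => `|x ^+ m|) by exact: measurableT_comp.
have m1 : measurable_fun setT f1.
  by apply: measurable_funM => //; exact: measurable_funD.
have m2 : measurable_fun setT f2.
  by apply: measurable_funM => //; exact: measurable_funB.
have hb x : [/\ 0 <= f1 x, 0 <= f2 x, f1 x <= `|x ^+ m| & f2 x <= `|x ^+ m|].
  rewrite /f1 /f2; have := ler_norm (x ^+ m); have := ler_norm (- x ^+ m).
  by rewrite normrN => h1 h2; split; lra.
have h1 : all_moments (fun w => f1 (X w)).
  apply: (all_moments_le _ _ (all_momentsX m hX)); first exact: measurableT_comp.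
  by move=> w; have [a0 _ a1 _] := hb (X w); rewrite ger0_norm.
have h2 : all_moments (fun w => f2 (X w)).
  apply: (all_moments_le _ _ (all_momentsX m hX)); first exact: measurableT_comp.
  by move=> w; have [_ a0 _ a1] := hb (X w); rewrite ger0_norm.
have dec Y : all_moments Y -> Ex (fun w => X w ^+ m * Y w) =
    Ex (fun w => f1 (X w) * Y w) + (-1) * Ex (fun w => f2 (X w) * Y w).
  move=> hY; have hf2 := all_momentsM h2 hY.
  rewrite -ExZ // -ExD; last by apply: all_momentsM => //; exact: all_moments_cst.
    by congr Ex; apply/funext => w; rewrite /f1 /f2; field.
  exact: all_momentsM.
rewrite !dec // (Ex_test_ge0 m1) //; last by move=> x; case: (hb x).
by rewrite (Ex_test_ge0 m2) //; [ring | move=> x; case: (hb x)].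
Qed.

End TestFunctions.

Section Independence.
Variables (I : finType) (X : I -> {RV P >-> R}) (CC : {set {set I}}).
Hypothesis hX : forall q, all_moments (X q).
Hypothesis CCP : forall q, exists C0, [/\ C0 \in CC, q \in C0 &
  forall C, C \in CC -> q \in C -> C = C0].
Hypothesis indep : forall B : I -> set R, (forall q, measurable (B q)) ->
  P (\bigcap_(q in [set: I]) (X q @^-1` B q)) =
  (\prod_(C in CC) P (\bigcap_(q in [set q | q \in C]) (X q @^-1` B q)))%E.
Variable m : I -> nat.

(* Indicators are replaced by powers one variable at a time; [S] lists those done. *)
Let phi (S : seq I) (B : I -> set R) q w :=
  if q \in S then X q w ^+ m q else \1_(B q) (X q w).

Let phi_moments S B q : (forall q, measurable (B q)) -> all_moments (phi S B q).
Proof.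
move=> mB; rewrite /phi; case: (q \in S); first exact: all_momentsX.
exact: all_moments_indic.
Qed.

Let Ex_indic_prod (A : {set I}) B : (forall q, measurable (B q)) ->
  Ex (fun w => \prod_(q in A) \1_(B q) (X q w)) =
  fine (P (\bigcap_(q in [set q | q \in A]) (X q @^-1` B q))).
Proof.
move=> mB; set D := \bigcap_(_ in _) _.
have mD : measurable D.
  apply: fin_bigcap_measurable; first exact: finite_finset.
  by move=> q _; rewrite -[_ @^-1` _]setTI; exact: measurable_funPT.
have -> : (fun w => \prod_(q in A) \1_(B q) (X q w)) = (\1_D : T -> R).
  apply/funext => w; rewrite indicE; have [/set_mem wD|wD] := boolP (w \in D).
    by rewrite big1 // => q qA; rewrite indicE mem_set //; exact: wD.
  have [q qA qw] : exists2 q, q \in A & ~ B q (X q w).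
    apply: contrapT => H; move/negP: wD; apply; apply: mem_set => q /= qA.
    by apply: contrapT => Bq; apply: H; exists q.
  by rewrite (bigD1 q) //= indicE memNset // mul0r.
by rewrite /Ex integral_indic // setIT.
Qed.

(** [X q0] occurs only in the factor of its own class [C0]; the other factors form the constant [K].
    The induction hypothesis, with [B q0] arbitrary, is an identity tested on all indicators of
    [X q0] and therefore extends to its powers. *)
Let indep_step S B : (forall q, measurable (B q)) ->
  Ex (fun w => \prod_q phi S B q w) = \prod_(C in CC) Ex (fun w => \prod_(q in C) phi S B q w).
Proof.
elim: S B => [|q0 S IH] B mB.
  have -> : (fun w => \prod_q phi [::] B q w) =
      fun w => \prod_(q in [set: I]%SET) \1_(B q) (X q w).
    by apply/funext => w; apply: eq_bigl => q; rewrite finset.in_setT.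
  rewrite Ex_indic_prod //.
  rewrite (_ : [set q | q \in [set: I]%SET] = [set: I]); last first.
    by apply/seteqP; split=> q // _; exact: finset.in_setT.
  rewrite indep // (eq_bigr (fun C : {set I} => (Ex (fun w => \prod_(q in C) phi [::] B q w))%:E)).
    by rewrite -(big_morph EFin EFinM erefl).
  move=> C _; rewrite /phi /= Ex_indic_prod // fineK //; apply: fin_num_measure.
  apply: fin_bigcap_measurable; first exact: finite_finset.
  by move=> q _; rewrite -[_ @^-1` _]setTI; exact: measurable_funPT.
have [q0S|q0S] := boolP (q0 \in S).
  have e : phi (q0 :: S) B = phi S B.
    apply/funext => q; apply/funext => w; rewrite /phi inE.
    by case: eqVneq => [->|] //=; rewrite q0S.
  by rewrite e; exact: IH.
have [C0 [C0C q0C C0u]] := CCP q0.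
pose F := phi (q0 :: S) B.
have FE q w : q != q0 -> F q w = phi S B q w by move=> h; rewrite /F /phi inE (negbTE h).
pose G w := \prod_(q | q != q0) F q w.
pose H w := \prod_(q in C0 | q != q0) F q w.
pose K := \prod_(C in CC | C != C0) Ex (fun w => \prod_(q in C) F q w).
have hF q : all_moments (F q) by exact: phi_moments.
have split_l (f : I -> T -> R) : (fun w => \prod_q f q w) = fun w => f q0 w * \prod_(q | q != q0) f q w.
  by apply/funext => w; rewrite (bigD1 q0).
have split_r (f : I -> T -> R) : \prod_(C in CC) Ex (fun w => \prod_(q in C) f q w) =
    Ex (fun w => f q0 w * \prod_(q in C0 | q != q0) f q w) *
    \prod_(C in CC | C != C0) Ex (fun w => \prod_(q in C) f q w).
  rewrite (bigD1 C0) //=; congr (Ex _ * _).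
  by apply/funext => w; rewrite (bigD1 q0).
rewrite split_l split_r -/F.
have F0 w : F q0 w = X q0 w ^+ m q0 by rewrite /F /phi mem_head.
rewrite (_ : (fun w => _) = fun w => X q0 w ^+ m q0 * G w); last by apply/funext => w; rewrite F0.
rewrite (_ : (fun w => F q0 w * _) = fun w => X q0 w ^+ m q0 * H w); last by apply/funext => w; rewrite F0.
apply: Ex_test_pow => //; [exact: all_moments_prod | exact: all_moments_prod |].
move=> D mD; pose B' q := if q == q0 then D else B q.
have mB' q : measurable (B' q) by rewrite /B'; case: ifP.
have := IH B' mB'; rewrite split_l split_r.
have phiE q w : q != q0 -> phi S B' q w = F q w.
  by move=> qq; rewrite FE // /phi /B' (negbTE qq).
have phi0 w : phi S B' q0 w = \1_D (X q0 w) by rewrite /phi (negbTE q0S) /B' eqxx.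
rewrite (_ : (fun w => _) = fun w => \1_D (X q0 w) * G w); last first.
  by apply/funext => w; rewrite phi0; congr (_ * _); apply: eq_bigr => q; exact: phiE.
move=> ->; congr (Ex _ * _).
  by apply/funext => w; rewrite phi0; congr (_ * _); apply: eq_bigr => q /andP [_]; exact: phiE.
apply: eq_bigr => C /andP [CC' CC0]; congr Ex; apply/funext => w; apply: eq_bigr => q qC.
apply: phiE; apply: contraNneq CC0 => e; apply/eqP; apply: C0u => //.
by rewrite -e.
Qed.

Lemma indep_moments : Ex (fun w => \prod_q X q w ^+ m q) =
  \prod_(C in CC) Ex (fun w => \prod_(q in C) X q w ^+ m q).
Proof.
have := @indep_step (enum I) (fun=> setT) (fun=> measurableT).
have e q w : phi (enum I) (fun=> setT) q w = X q w ^+ m q by rewrite /phi mem_enum.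
rewrite (_ : (fun w => _) = fun w => \prod_q X q w ^+ m q); last first.
  by apply/funext => w; apply: eq_bigr => q _; exact: e.
move=> ->; apply: eq_bigr => C _; congr Ex; apply/funext => w; apply: eq_bigr => q _; exact: e.
Qed.

End Independence.

End Moments.

(** * The trace expansion *)

Section PairPartitionLists.
Variables (k : nat) (p : {ffun 'I_k -> 'I_k}).

Lemma size_ppseq : size (ppseq p) = k.
Proof. by rewrite size_map size_enum_ord. Qed.

Lemma nth_ppseq (j : 'I_k) : nth 0%N (ppseq p) j = p j.
Proof. by rewrite (nth_map j) ?size_enum_ord // nth_ord_enum. Qed.

Lemma pairing_ppseq : (forall j, p j != j /\ p (p j) = j) -> pairing (ppseq p).
Proof.
move=> pP j; rewrite size_ppseq => jk; have [p1 p2] := pP (Ordinal jk).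
have e := nth_ppseq (Ordinal jk); rewrite /= in e.
rewrite e nth_ppseq p2; split=> // e'; move/eqP: p1; apply; exact: val_inj.
Qed.

Lemma noncrossing_ppseq : ~~ [exists a : 'I_k, exists b : 'I_k,
  (a < b)%N && (b < p a)%N && (p a < p b)%N] <-> noncrossing (ppseq p).
Proof.
split=> [nc a b|nc].
  rewrite size_ppseq => ak bk ab.
  have ea := nth_ppseq (Ordinal ak); have eb := nth_ppseq (Ordinal bk).
  rewrite /= in ea eb; rewrite ea eb => h1 h2.
  move/negP: nc; apply; apply/existsP; exists (Ordinal ak).
  by apply/existsP; exists (Ordinal bk); rewrite /= ab h1 h2.
apply/negP => /existsP [a /existsP [b /andP [/andP [h1 h2] h3]]].
by apply: (nc a b); rewrite ?size_ppseq ?nth_ppseq.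
Qed.

Lemma is_ncppP : is_ncpp p <->
  (forall j, p j != j /\ p (p j) = j) /\ noncrossing (ppseq p).
Proof.
rewrite /is_ncpp; split=> [/andP [/forallP pP /noncrossing_ppseq nc]|[pP nc]].
  by split=> // j; have /andP [h /eqP] := pP j.
apply/andP; split; last exact/noncrossing_ppseq.
by apply/forallP => j; have [h ->] := pP j; rewrite h eqxx.
Qed.

End PairPartitionLists.

Section BadTuples.
Variables (N : nat) (x0 : 'I_N) (r : rel ('I_N * 'I_N)) (B : nat).
Hypothesis r_equiv : equivalence_rel r.
Hypothesis r_flip : forall p q : 'I_N, r (p, q) (q, p).
Hypothesis rB : forall p q q' : 'I_N, (#|[set s | r (p, q) (q', s)]%SET| <= B)%N.
Hypothesis B0 : (0 < B)%N.

Definition links (s : seq nat) (i : seq 'I_N) := forall j, (j < size s)%N ->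
  r (edge x0 i j) (edge x0 i (nth 0%N s j)).

(** The set [bad] with the length [k] as a parameter, since [size (ppseq p)] equals [k] only by
    rewriting. *)
Definition bad_tuples k (s : seq nat) : {set k.-tuple 'I_N} :=
  [set i : k.-tuple 'I_N | `[< links s i /\ ~ (noncrossing s /\ folds x0 s i) >]]%SET.

Lemma card_bad_tuples k s : size s = k -> pairing s -> (1 < k)%N ->
  (#|bad_tuples k s| * N <= k * B ^ k * (\max_(p : 'I_N)
      #|[set t : 'I_N * 'I_N * 'I_N | r (p, t.1.1) (t.1.2, t.2)]%SET| +
     #|[set t : 'I_N * 'I_N * 'I_N | r (t.1.1, t.1.2) (t.1.2, t.2) && (t.2 != t.1.1)]%SET|)
     * N ^ k./2)%N.
Proof.
move=> sk; subst k => sP s2.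
have := card_bad x0 r_equiv r_flip rB B0 sP s2.
suff -> : bad_tuples (size s) s = bad x0 r s by [].
apply/finset.setP => i; rewrite !inE; apply/asboolP/andP => [[h1 h2]|[h1 h2]].
  by split; [apply/forallP => j; exact: h1 | apply/asboolPn].
by split; [move=> j hj; move/forallP: h1 => /(_ (Ordinal hj)) | move/asboolPn: h2].
Qed.

End BadTuples.

Section TraceExpansion.
Variables (R : comPzRingType) (N : nat) (M : 'M[R]_N).

Fixpoint path_prod (a : 'I_N) (w : seq 'I_N) (b : 'I_N) : R :=
  if w is c :: w' then M a c * path_prod c w' b else M a b.

Lemma big_tuple_cons n (F : n.+1.-tuple 'I_N -> R) :
  \sum_(i : n.+1.-tuple 'I_N) F i = \sum_(a < N) \sum_(w : n.-tuple 'I_N) F [tuple of a :: w].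
Proof.
rewrite pair_big /= (reindex (fun q : 'I_N * n.-tuple 'I_N => [tuple of q.1 :: q.2])) //=.
exists (fun a : n.+1.-tuple 'I_N => (thead a, behead_tuple a)) => [[i a] _|a _] /=.
  by congr pair; apply: val_inj.
by rewrite [RHS]tuple_eta; apply: val_inj.
Qed.

Lemma mxpow_path n a b :
  (M ^+ n.+1) a b = \sum_(w : n.-tuple 'I_N) path_prod a w b.
Proof.
elim: n a b => [|n IH] a b.
  rewrite expr1 (bigD1 [tuple]) //= big1 ?addr0 // => w.
  by move=> /eqP []; apply: tuple0.
rewrite exprS -mulmxE mxE big_tuple_cons; apply: eq_bigr => c _.
by rewrite IH mulr_sumr.
Qed.

Lemma path_prodE x0 a w b : path_prod a w b =
  \prod_(j < (size w).+1) M (nth x0 (a :: w) j) (nth x0 (rcons w b) j).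
Proof.
elim: w a => [|c w IH] a; first by rewrite big_ord1.
by rewrite /= IH [RHS]big_ord_recl.
Qed.

Lemma trace_exp x0 k : (0 < k)%N -> \tr (M ^+ k) = \sum_(i : k.-tuple 'I_N)
  \prod_(j < k) M (edge x0 i j).1 (edge x0 i j).2.
Proof.
case: k => // n _.
rewrite /mxtrace big_tuple_cons; apply: eq_bigr => a _.
rewrite mxpow_path; apply: eq_bigr => w _; rewrite (path_prodE x0).
rewrite (eq_bigr (fun j : 'I_(size w).+1 => M (edge x0 (a :: w) j).1 (edge x0 (a :: w) j).2)).
  by rewrite size_tuple.
move=> [j jn] _; rewrite /edge /=; congr (M _ _).
move: jn; rewrite ltnS leq_eqVlt => /predU1P [->|jn].
  by rewrite modnn nth_rcons ltnn eqxx.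
by rewrite modn_small //= nth_rcons jn.
Qed.

End TraceExpansion.

Lemma prod_le_sum_pow (R : realFieldType) k (x : 'I_k -> R) : (0 < k)%N ->
  (forall j, 0 <= x j) -> \prod_(j < k) x j <= \sum_(j < k) x j ^+ k.
Proof.
case: k x => // k x _ x0.
case: (@Order.TotalTheory.arg_maxP _ _ _ ord0 xpredT x isT) => j0 _ jmax.
apply: (@le_trans _ _ (x j0 ^+ k.+1)).
  rewrite -[in leRHS](card_ord k.+1) -prodr_const.
  by apply: ler_prod => j _; apply/andP; split; [exact: x0|exact: jmax].
by rewrite (bigD1 j0) //= lerDl sumr_ge0 // => j _; rewrite exprn_ge0.
Qed.

(** * Mixed moments along a walk *)

Section MixedMoments.
Context (R : realType) (d : measure_display) (T : measurableType d) (P : probability T R).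
Variables (N : nat) (x0 : 'I_N) (X : 'I_N -> 'I_N -> {RV P >-> R}) (r : rel ('I_N * 'I_N)).
Variable Rk : nat -> R.
Hypothesis Xsym : forall i j w, X i j w = X j i w.
Hypothesis X1 : forall i j, ('E_P[X i j] = 0)%E.
Hypothesis X2 : forall i j, ('E_P[fun w => (X i j w ^+ 2)%R] = 1)%E.
Hypothesis XR : forall k i j, ('E_P[fun w => (`|X i j w| ^+ k)%R] <= (Rk k)%:E)%E.
Hypothesis r_equiv : equivalence_rel r.
Hypothesis indep : indep_classes X r.

Lemma ExE (Z : T -> R) : Ex P Z = fine ('E_P[Z])%E.
Proof. by rewrite /Ex unlock. Qed.

Lemma entry_moments i j : all_moments P (X i j).
Proof.
split=> [|n]; first exact: measurable_funPT.
by have := XR n i j; rewrite unlock => /le_lt_trans; apply; rewrite ltry.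
Qed.

Lemma Ex_le (Z W : T -> R) : all_moments P Z -> all_moments P W ->
  (forall w, Z w <= W w) -> Ex P Z <= Ex P W.
Proof.
move=> hZ hW ZW; apply: fine_le; [exact: all_moments_fin|exact: all_moments_fin|].
apply: le_integral => //; first exact (all_moments_integrable hZ).
  exact (all_moments_integrable hW).
by move=> w _; rewrite lee_fin.
Qed.

Variables (k : nat) (i : seq 'I_N).
Local Notation e := (edge x0 i).
Local Notation Y := (fun q : 'I_N * 'I_N => X q.1 q.2).

Definition mixed_moment := Ex P (fun w => \prod_(j < k) Y (e j) w).

Let CC : {set {set 'I_N * 'I_N}} := [set [set q | r p q] | p : 'I_N * 'I_N]%SET.

(** A walk may repeat an edge. Counting visits as exponents turns the product over positions into
    one over index pairs, the form in which independence applies. *)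
Let prod_by_edge (A : {set 'I_N * 'I_N}) (F : 'I_N * 'I_N -> R) :
  \prod_(q in A) F q ^+ #|[pred j : 'I_k | e j == q]| = \prod_(j < k | e j \in A) F (e j).
Proof.
rewrite [RHS](partition_big (fun j : 'I_k => e j) [in A]) //=.
apply: eq_bigr => q qA; rewrite -prodr_const; apply: eq_big => [j|j].
  by rewrite inE; case: eqVneq => [->|]; rewrite ?qA ?andbF.
by rewrite inE => /eqP ->.
Qed.

Lemma mixed_moment_classes : mixed_moment =
  \prod_(C in CC) Ex P (fun w => \prod_(j < k | e j \in C) Y (e j) w).
Proof.
pose m (q : 'I_N * 'I_N) := #|[pred j : 'I_k | e j == q]|.
have rr q : r q q by exact: (r_refl r_equiv).
have := @indep_moments R d T P ('I_N * 'I_N)%type Y CC _ _ _ m.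
rewrite (_ : (fun w => \prod_q _) = fun w => \prod_(j < k) Y (e j) w); last first.
  apply/funext => w; have := prod_by_edge [set: _]%SET (fun q => Y q w).
  rewrite (eq_bigl xpredT) => [->|q]; last by rewrite finset.in_setT.
  by apply: eq_bigl => j; rewrite finset.in_setT.
move=> H; rewrite /mixed_moment {}H //.
- by apply: eq_bigr => C _; congr Ex; apply/funext => w; exact: prod_by_edge.
- by move=> q; exact: entry_moments.
- move=> q; exists [set q' | r q q']%SET; split.
  + by apply/imsetP; exists q.
  + by rewrite inE.
  + move=> C /imsetP [q' _ ->]; rewrite inE => rq; apply/finset.setP => q''; rewrite !inE.
    by have [_ /(_ rq) ->] := r_equiv q' q q''.
Qed.

Lemma mixed_moment_singleton (j : 'I_k) :
  (forall l : 'I_k, r (e j) (e l) -> l = j) -> mixed_moment = 0.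
Proof.
move=> sj; rewrite mixed_moment_classes (bigD1 [set q | r (e j) q]%SET) /=; last first.
  by apply/imsetP; exists (e j).
rewrite (_ : (fun w => _) = Y (e j)); first by rewrite ExE X1 mul0r.
apply/funext => w; rewrite (bigD1 j) /=; last by rewrite inE (r_refl r_equiv).
rewrite big1 ?mulr1 // => l /andP []; rewrite inE => /sj -> /eqP //.
Qed.

(** The two traversals in a class are opposite, so symmetry of the matrix makes their product a
    square of mean one. Classes missed by the walk contribute an empty product. *)
Lemma mixed_moment_pairing (p : {ffun 'I_k -> 'I_k}) :
  (forall j, p j != j /\ p (p j) = j) ->
  (forall j l : 'I_k, r (e j) (e l) = (l == j) || (l == p j)) ->
  (forall j : 'I_k, e (p j) = ((e j).2, (e j).1)) -> mixed_moment = 1.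
Proof.
move=> pP rE flip; rewrite mixed_moment_classes big1 // => C /imsetP [q _ ->].
have [/existsP [j rj]|/existsPn nj] := boolP [exists j : 'I_k, r q (e j)].
  rewrite (_ : (fun w => _) = fun w => Y (e j) w ^+ 2); first by rewrite ExE X2.
  apply/funext => w.
  rewrite (eq_bigl (fun l : 'I_k => (l == j) || (l == p j))) => [|l]; last first.
    by rewrite inE -rE; have [_ /(_ rj) ->] := r_equiv q (e j) (e l).
  have [pj _] := pP j.
  rewrite (bigD1 j) ?eqxx //= (bigD1 (p j)) /=; last by rewrite eqxx orbT pj.
  rewrite big1 => [|l /andP [/andP [/orP [] /eqP -> ]]]; rewrite ?eqxx //.
  have := flip j; rewrite /edge /= => -[-> ->].
  by rewrite mulr1 [in X in _ * X]Xsym expr2.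
rewrite (_ : (fun w => _) = fun=> 1) ?Ex_cst //.
by apply/funext => w; rewrite big1 // => j; rewrite inE (negbTE (nj j)).
Qed.

Lemma mixed_moment_bound : (0 < k)%N -> `|mixed_moment| <= k%:R * Rk k.
Proof.
move=> k0.
have hp : all_moments P (fun w => \prod_(j < k) Y (e j) w).
  by apply: all_moments_prod => j; exact: entry_moments.
have hn (j : 'I_k) : all_moments P (fun w => `|Y (e j) w| ^+ k).
  apply: all_momentsX; apply: (all_moments_le _ _ (entry_moments (e j).1 (e j).2)).
    by apply: measurableT_comp => //; exact: measurable_funPT.
  by move=> w; rewrite normr_id.
have hs : all_moments P (fun w => \sum_(j < k) `|Y (e j) w| ^+ k).
  exact: all_moments_sum.
have le1 w : `|\prod_(j < k) Y (e j) w| <= \sum_(j < k) `|Y (e j) w| ^+ k.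
  by rewrite normr_prod; exact: prod_le_sum_pow.
have le2 : Ex P (fun w => \sum_(j < k) `|Y (e j) w| ^+ k) <= k%:R * Rk k.
  rewrite Ex_sum // (_ : k%:R * Rk k = \sum_(j < k) Rk k); last first.
    by rewrite sumr_const card_ord mulr_natl.
  apply: ler_sum => j _.
  rewrite -lee_fin ExE fineK; first exact: XR.
  by have := all_moments_fin (hn j); rewrite unlock.
have hN : all_moments P (fun w => -1 * \prod_(j < k) Y (e j) w).
  by apply: all_momentsM => //; exact: all_moments_cst.
rewrite ler_norml; apply/andP; split.
  rewrite lerNl -mulN1r -ExZ //; apply: (le_trans (Ex_le hN hs _)) => // w.
  by rewrite mulN1r (le_trans _ (le1 w)) // -normrN ler_norm.
by apply: (le_trans (Ex_le hp hs _)) => // w; rewrite (le_trans _ (le1 w)) // ler_norm.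
Qed.

End MixedMoments.

Section TraceTerms.
Context (R : realType) (d : measure_display) (T : measurableType d) (P : probability T R).
Variables (N : nat) (x0 : 'I_N) (X : 'I_N -> 'I_N -> {RV P >-> R}) (r : rel ('I_N * 'I_N)).
Variables (Rk : nat -> R) (alpha : R -> R) (C : R) (k : nat).
Hypothesis Xsym : forall i j w, X i j w = X j i w.
Hypothesis X1 : forall i j, ('E_P[X i j] = 0)%E.
Hypothesis X2 : forall i j, ('E_P[fun w => (X i j w ^+ 2)%R] = 1)%E.
Hypothesis XR : forall k i j, ('E_P[fun w => (`|X i j w| ^+ k)%R] <= (Rk k)%:E)%E.
Hypothesis r_equiv : equivalence_rel r.
Hypothesis r_flip : forall p q : 'I_N, r (p, q) (q, p).
Hypothesis indep : indep_classes X r.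
Hypothesis alphaC : forall x : R, 0 <= x <= 1 -> `|alpha x| <= C.
Hypothesis C1 : 1 <= C.
Hypothesis k0 : (0 < k)%N.

Definition weight (q : 'I_N * 'I_N) := alpha (`|q.1%:R - q.2%:R| / N%:R).

Lemma weight_flip a b : weight (a, b) = weight (b, a).
Proof. by rewrite /weight /= distrC. Qed.

Lemma weight_bound q : `|weight q| <= C.
Proof.
apply: alphaC; have N0 : 0 < N%:R :> R by rewrite ltr0n; case: (N) x0 => // -[].
rewrite divr_ge0 //= ler_pdivrMr // mul1r -natdistE ler_nat /natdist.
have := ltn_ord q.1; have := ltn_ord q.2; lia.
Qed.

Definition trace_term (i : k.-tuple 'I_N) : R :=
  (\prod_(j < k) weight (edge x0 i j)) * mixed_moment x0 X k i.

Definition tree_term (p : {ffun 'I_k -> 'I_k}) (i : seq 'I_N) : R :=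
  \prod_(j < k | (j < p j)%N) weight (edge x0 i j) ^+ 2.

Let is_pairing (p : {ffun 'I_k -> 'I_k}) := [forall j, (p j != j) && (p (p j) == j)].

Let is_pairingP (p : {ffun 'I_k -> 'I_k}) : reflect (forall j, p j != j /\ p (p j) = j) (is_pairing p).
Proof.
apply: (iffP forallP) => H j; first by have /andP [h /eqP] := H j.
by have [h ->] := H j; rewrite h eqxx.
Qed.

Let folds_flip (p : {ffun 'I_k -> 'I_k}) (i : k.-tuple 'I_N) (j : 'I_k) :
  is_pairing p -> folds x0 (ppseq p) i ->
  edge x0 i (p j) = ((edge x0 i j).2, (edge x0 i j).1).
Proof.
move=> /is_pairingP pP fi; have [_ ppj] := pP j.
have h1 := fi j; have h2 := fi (p j).
rewrite size_ppseq nth_ppseq in h1; rewrite size_ppseq nth_ppseq ppj in h2.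
by rewrite (h1 (ltn_ord j)) -(h2 (ltn_ord (p j))); case: (edge x0 i (p j)).
Qed.

(** A folding pairing links its blocks through [r_flip]. With enough classes the linked positions
    form a unique matching, which must then be [p]. *)
Let folds_classes p (i : k.-tuple 'I_N) : is_pairing p -> folds x0 (ppseq p) i ->
  (k <= (nclasses x0 r i).*2)%N ->
  forall j l : 'I_k, r (edge x0 i j) (edge x0 i l) = (l == j) || (l == p j).
Proof.
move=> pp fi few; have /is_pairingP pP := pp.
have rp (j : 'I_k) : r (edge x0 i j) (edge x0 i (p j)).
  by rewrite (folds_flip _ pp fi); case: (edge x0 i j) => a b; exact: r_flip.
have ns (j : 'I_k) : exists2 l : 'I_k, l != j & r (edge x0 i j) (edge x0 i l).
  by exists (p j) => //; case: (pP j).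
have [p' p'P rE] := exists_matching r_equiv ns few.
suff -> : p = p' by exact: rE.
apply/ffunP => j; have := rp j; rewrite rE; have [/negbTE -> _] := pP j.
by move=> /eqP.
Qed.

Let tree_prod p (i : k.-tuple 'I_N) : is_pairing p -> folds x0 (ppseq p) i ->
  \prod_(j < k) weight (edge x0 i j) = tree_term p i.
Proof.
move=> pp fi; have /is_pairingP pP := pp.
rewrite (bigID (fun j : 'I_k => (j < p j)%N)) /= /tree_term.
have pK : involutive p by move=> j; case: (pP j).
rewrite [X in _ * X](reindex_inj (inv_inj pK)) /=.
rewrite [X in _ * X](eq_bigl (fun j : 'I_k => (j < p j)%N)) => [|j]; last first.
  rewrite pK -leqNgt leq_eqVlt; have [+ _] := pP j.
  by rewrite -(inj_eq val_inj) eq_sym /= => /negbTE ->.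
rewrite -big_split /=; apply: eq_bigr => j _; rewrite (folds_flip _ pp fi) expr2.
by congr (_ * _); rewrite weight_flip; case: (edge x0 i j).
Qed.

(* Outside the exceptional tuples a nonzero term has its edges matched by exactly one
   pairing, and this pairing is noncrossing and folded. *)
Lemma trace_term_tree (i : k.-tuple 'I_N) : (k <= (nclasses x0 r i).*2)%N ->
  (forall p, is_pairing p -> i \notin bad_tuples x0 r k (ppseq p)) ->
  trace_term i = \sum_(p | is_ncpp p && `[< folds x0 (ppseq p) i >]) tree_term p i.
Proof.
move=> few nbad.
have ncP p : is_ncpp p -> is_pairing p by case/andP.
have [/existsP [p0 /andP [nc0 /asboolP f0]]|/existsPn none] :=
    boolP [exists p : {ffun 'I_k -> 'I_k}, is_ncpp p && `[< folds x0 (ppseq p) i >]].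
  have pp0 := ncP _ nc0; have rE := folds_classes pp0 f0 few.
  rewrite (big_pred1 p0) => [|p]; last first.
    apply/idP/eqP => [/andP [/ncP pp /asboolP f]|->]; last first.
      by rewrite nc0; apply/asboolP.
    apply/ffunP => j; have := rE j (p j); rewrite (folds_classes pp f few) eqxx orbT.
    by have /is_pairingP/(_ j) [/negbTE -> _] := pp => /esym /eqP.
  rewrite /trace_term (tree_prod pp0 f0).
  rewrite (mixed_moment_pairing Xsym X2 XR r_equiv indep (p := p0)) ?mulr1 //.
  - exact/is_pairingP.
  - by move=> j; exact: folds_flip.
rewrite big_pred0 => [|p]; last by apply/negbTE; exact: none.
have [/forallP ns|/forallPn [j /existsPn sj]] := boolP [forall j : 'I_k,
    [exists l : 'I_k, (l != j) && r (edge x0 i j) (edge x0 i l)]].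
  have ns' (j : 'I_k) : exists2 l : 'I_k, l != j & r (edge x0 i j) (edge x0 i l).
    by have /existsP [l /andP [h1 h2]] := ns j; exists l.
  have [p pP rE] := exists_matching r_equiv ns' few.
  have pp : is_pairing p by apply/is_pairingP.
  have li : links x0 r (ppseq p) i.
    move=> j; rewrite size_ppseq => jk; have := nth_ppseq p (Ordinal jk) => /= ->.
    by have := rE (Ordinal jk) (p (Ordinal jk)); rewrite eqxx orbT.
  have := nbad p pp; rewrite inE => /asboolP; case; split=> // -[nc f].
  by have := none p; rewrite negb_and => /orP [/negP|/asboolP] //; case; apply/is_ncppP.
rewrite /trace_term (mixed_moment_singleton X1 XR r_equiv indep (j := j)) ?mulr0 //.
move=> l rl; apply/eqP; apply: contraT => lj.
by have := sj l; rewrite lj rl.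
Qed.

Let C0 : 0 <= C. Proof. exact: le_trans C1. Qed.

Lemma trace_term_bound i : `|trace_term i| <= C ^+ k * (k%:R * Rk k).
Proof.
rewrite /trace_term normrM ler_pM //; last exact: mixed_moment_bound.
rewrite normr_prod -[in leRHS](card_ord k) -prodr_const.
by apply: ler_prod => j _; rewrite normr_ge0 weight_bound.
Qed.

Lemma tree_term_bound p i : 0 <= tree_term p i <= (C ^+ 2) ^+ k.
Proof.
apply/andP; split; first by rewrite prodr_ge0 // => j _; rewrite sqr_ge0.
apply: (@le_trans _ _ (\prod_(j < k | (j < p j)%N) C ^+ 2)).
  apply: ler_prod => j _; rewrite sqr_ge0 -real_normK ?num_real //.
  by rewrite lerXn2r ?nnegrE // weight_bound.
rewrite prodr_const ler_weXn2l ?exprn_ege1 // -[leqRHS](card_ord k).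
exact: max_card.
Qed.

Definition error_const : R :=
  C ^+ k * (k%:R * Rk k) + #|{ffun 'I_k -> 'I_k}|%:R * (C ^+ 2) ^+ k.

Lemma error_const_ge0 : 0 <= error_const.
Proof.
have h := le_trans (normr_ge0 _) (mixed_moment_bound x0 XR [::] k0).
apply: addr_ge0; first by apply: mulr_ge0 => //; rewrite exprn_ge0.
by rewrite mulr_ge0 // !exprn_ge0.
Qed.

Definition exceptions : nat :=
  (#|[set i : k.-tuple 'I_N | ((nclasses x0 r i).*2 < k)%N]%SET| +
   \sum_(p | is_pairing p) #|bad_tuples x0 r k (ppseq p)|)%N.

(** The difference vanishes on ordinary tuples and is at most [error_const] on every tuple; counting
    an exceptional tuple several times only weakens the bound. *)
Lemma trace_terms_error :
  `|\sum_i trace_term i -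
    \sum_(p | is_ncpp p) \sum_(i : k.-tuple 'I_N | `[< folds x0 (ppseq p) i >]) tree_term p i| <=
  error_const * exceptions%:R.
Proof.
rewrite (exchange_big_dep xpredT) //= -sumrB.
pose D i := trace_term i - \sum_(p | is_ncpp p && `[< folds x0 (ppseq p) i >]) tree_term p i.
pose few (i : k.-tuple 'I_N) := i \in [set i : k.-tuple 'I_N | ((nclasses x0 r i).*2 < k)%N]%SET.
pose bad (p : {ffun 'I_k -> 'I_k}) (i : k.-tuple 'I_N) := i \in bad_tuples x0 r k (ppseq p).
have M0 := error_const_ge0.
have Db i : `|D i| <= error_const.
  rewrite (le_trans (ler_normB _ _)) // lerD ?trace_term_bound //.
  rewrite (le_trans (ler_norm_sum _ _ _)) //.
  apply: (@le_trans _ _ (\sum_(p : {ffun 'I_k -> 'I_k}) (C ^+ 2) ^+ k)); last first.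
    by rewrite sumr_const mulr_natl.
  rewrite big_mkcond; apply: ler_sum => p _; case: ifP => _; last by rewrite !exprn_ge0.
  by have /andP [h1 h2] := tree_term_bound p i; rewrite ger0_norm.
have Dp i : `|D i| <= error_const * (few i + \sum_(p | is_pairing p) bad p i)%N%:R.
  have [fi|nfi] := boolP (few i).
    apply: (le_trans (Db i)); rewrite ler_peMr // ler1n add1n //.
  have [/existsP [p /andP [pp bp]]|/existsPn nb] :=
      boolP [exists p : {ffun 'I_k -> 'I_k}, is_pairing p && bad p i].
    by apply: (le_trans (Db i)); rewrite ler_peMr // ler1n (bigD1 p) //= bp add0n add1n.
  rewrite /D trace_term_tree ?subrr ?normr0 ?mulr_ge0 //.
    by move: nfi; rewrite /few inE -leqNgt.
  by move=> p pp; have := nb p; rewrite pp.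
apply: (le_trans (ler_norm_sum _ _ _)).
apply: (le_trans (ler_sum _ (fun i _ => Dp i))).
rewrite -mulr_sumr -natr_sum ler_wpM2l // ler_nat big_split /= leq_add //.
  by rewrite -sum1_card [leqRHS]big_mkcond.
rewrite exchange_big /= leq_sum // => p _.
by rewrite -sum1_card [leqRHS]big_mkcond.
Qed.

End TraceTerms.

(** * Folded walks as labellings of the tree vertices *)

Section TreeSums.
Variables (R : realType) (alpha : R -> R) (k : nat) (p : {ffun 'I_k -> 'I_k}).
Hypotheses (pnc : is_ncpp p) (k0 : (0 < k)%N).

Local Notation s := (ppseq p).
Local Notation g := (Gseq (ppseq p)).
Local Notation V := (undup g).

Let E := [seq (index e.1 V, index e.2 V) | e <- edges g].

Let sk : size s = k := size_ppseq p.

Let sP : pairing s. Proof. by apply: pairing_ppseq; case/is_ncppP: pnc. Qed.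

Let nc : noncrossing s. Proof. by case/is_ncppP: pnc. Qed.

Let k_even : ~~ odd k. Proof. by rewrite -sk; exact: pairing_even. Qed.

Let k1 : (1 < size s)%N. Proof. by rewrite sk; move: k0 k_even; case: k => [|[|]]. Qed.

Let gT : treelike 0%N s g. Proof. exact: Gseq_treelike. Qed.

Let sg : size g = k. Proof. by case: gT => ->. Qed.

Lemma size_tree_vertices : size V = (k./2).+1.
Proof. by case: gT => _ _ ->; rewrite sk. Qed.

Let mem_edges e : e \in edges g -> e.1 \in V /\ e.2 \in V.
Proof.
rewrite edgesE mem_undup => /mapP [j]; rewrite mem_iota /= add0n => jg ->.
have jg' : (j.+1 %% size g < size g)%N by rewrite ltn_mod sg.
by rewrite /uedge /edge /= !mem_undup /minn /maxn; case: ifP => _; rewrite !mem_nth.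
Qed.

Lemma tree_edges e : e \in E -> [/\ (e.1 < size V)%N, (e.2 < size V)%N & e.1 != e.2].
Proof.
move=> /mapP [f fg ->] /=; have [f1 f2] := mem_edges fg; rewrite !index_mem; split=> //.
apply: contraNneq (loopless_edges sP k1 gT fg) => h.
by rewrite -[f.1](nth_index 0%N f1) h nth_index.
Qed.

Lemma Jalpha_tree : Jalpha alpha s = fine (cube_int (size V) (fun x =>
  (\prod_(e <- E) alpha `|nth 0 x e.1 - nth 0 x e.2| ^+ 2)%:E)).
Proof.
rewrite /Jalpha; congr (fine (cube_int _ _)); apply/funext => x.
by rewrite big_map.
Qed.

Definition tree_sum N : R := \sum_(a : (size V).-tuple 'I_N) \prod_(e <- E)
    alpha (`|(nth 0%N (map val a) e.1)%:R - (nth 0%N (map val a) e.2)%:R| / N%:R) ^+ 2.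

Section FixedSize.
Variables (N : nat) (x0 : 'I_N).

(** A labelling of the tree vertices, read along [g], is a folded walk; [refold] recovers the label
    of a vertex from its first visit. *)
Let unfold (a : (size V).-tuple 'I_N) : k.-tuple 'I_N :=
  [tuple nth x0 a (index (nth 0%N g j) V) | j < k].

Let refold (i : k.-tuple 'I_N) : (size V).-tuple 'I_N :=
  [tuple nth x0 i (index (nth 0%N V v) g) | v < size V].

Let nth_unfold a j : (j < k)%N -> nth x0 (unfold a) j = nth x0 a (index (nth 0%N g j) V).
Proof. by move=> jk; rewrite (nth_mktuple _ _ (Ordinal jk)). Qed.

Let nth_refold i v : (v < size V)%N -> nth x0 (refold i) v = nth x0 i (index (nth 0%N V v) g).
Proof. by move=> vV; rewrite (nth_mktuple _ _ (Ordinal vV)). Qed.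

Let gV j : (j < k)%N -> nth 0%N g j \in V.
Proof. by move=> jk; rewrite mem_undup mem_nth // sg. Qed.

Let unfoldK : cancel unfold refold.
Proof.
move=> a; apply: val_inj; apply: (@eq_from_nth _ x0); rewrite !size_tuple // => v vV.
have vg : nth 0%N V v \in g by rewrite -mem_undup mem_nth.
rewrite nth_refold // nth_unfold; last by rewrite -[X in (_ < X)%N]sg index_mem.
by rewrite nth_index // index_uniq // undup_uniq.
Qed.

(** A folded tuple is constant on the positions where [g] visits a given vertex, so reading first
    visits loses nothing. *)
Let refoldK (i : k.-tuple 'I_N) : folds x0 s i -> unfold (refold i) = i.
Proof.
move=> fi; apply: val_inj; apply: (@eq_from_nth _ x0); rewrite !size_tuple // => j jk.
rewrite nth_unfold // nth_refold ?index_mem ?gV // nth_index ?gV //.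
apply: (treelike_factor sP nc k1 gT _ fi); rewrite ?sk ?size_tuple //.
  by rewrite -[X in (_ < X)%N]sg index_mem mem_nth // sg.
by rewrite nth_index // mem_nth // sg.
Qed.

Let edge_unfold a j : (j < k)%N -> edge x0 (unfold a) j =
  (nth x0 a (index (edge 0%N g j).1 V), nth x0 a (index (edge 0%N g j).2 V)).
Proof.
by move=> jk; rewrite /edge sg (size_tuple (unfold a)) !nth_unfold ?ltn_mod.
Qed.

Let unfold_folds a : folds x0 s (unfold a).
Proof.
move=> j; rewrite sk => jk; have [_ gf _] := gT.
have [h _ _] := sP (ltac:(by rewrite sk) : (j < size s)%N); rewrite sk in h.
by rewrite !edge_unfold //; congr (nth x0 a (index _ V)); apply: gf; rewrite sk.
Qed.

Lemma tree_sumE :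
  \sum_(i : k.-tuple 'I_N | `[< folds x0 s i >]) tree_term x0 alpha p i = tree_sum N.
Proof.
rewrite (reindex_onto unfold refold) => [|i /asboolP]; last exact: refoldK.
apply: eq_big => [a|a _].
  by rewrite unfoldK eqxx andbT; apply/asboolP; exact: unfold_folds.
have perm := perm_openers_edges sP k1 gT.
rewrite big_map -(perm_big _ perm) big_map /= big_filter /tree_term.
rewrite sk -[X in iota _ X](subn0 k) -/(index_iota _ _) big_mkord.
apply: eq_big => [j|j _]; first by rewrite nth_ppseq.
congr (_ ^+ 2); rewrite edge_unfold // /weight /=; congr (alpha (_ / _)).
have h1 : nth 0%N g j \in V by exact: gV.
have h2 : nth 0%N g (j.+1 %% size g) \in V by apply: gV; rewrite sg ltn_mod.
have valE v : v \in V -> nth 0%N (map val a) (index v V) = val (nth x0 a (index v V)).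
  by move=> vV; rewrite (nth_map x0) // size_tuple index_mem.
rewrite /edge /= -!valE // /minn /maxn; case: ifP => _ //.
by rewrite distrC.
Qed.

End FixedSize.

Lemma tree_sum_cvg (C : R) : (forall x : R, 0 <= x <= 1 -> `|alpha x| <= C) ->
  riemann_integrable01 alpha ->
  (fun N : nat => (N%:R ^+ (k./2).+1)^-1 * tree_sum N)
  @ \oo --> Jalpha alpha s.
Proof.
move=> aC aR; rewrite Jalpha_tree -size_tree_vertices.
exact: (riemann_cube aC aR tree_edges).
Qed.

End TreeSums.

Lemma cvg_inv_sqrt (R : realType) : (fun N : nat => (Num.sqrt N%:R : R)^-1) @ \oo --> (0 : R).
Proof.
apply/cvgrPdist_lt => e e0; exists (Num.truncn (e ^- 2)).+1 => // N /= hN.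
have e2 : 0 <= e ^- 2 by rewrite invr_ge0 exprn_ge0 // ltW.
have /andP [_ h] := truncn_itv e2.
have hN' : e ^- 2 < N%:R by apply: lt_le_trans h _; rewrite ler_nat.
rewrite sub0r normrN ger0_norm ?invr_ge0 ?sqrtr_ge0 //.
rewrite -[e]invrK ltf_pV2 ?posrE ?invr_gt0 // ?sqrtr_gt0; last by apply: le_lt_trans hN'.
rewrite -[e^-1]ger0_norm ?invr_ge0 ?ltW // -sqrtr_sqr ltr_sqrt ?exprVn //.
exact: le_lt_trans hN'.
Qed.

Section MomentExpansion.
Context (R : realType) (d : measure_display) (T : measurableType d) (P : probability T R).
Variables (alpha : R -> R) (X : forall N : nat, 'I_N -> 'I_N -> {RV P >-> R}).
Variables (Rk : nat -> R) (k N : nat) (x0 : 'I_N).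
Hypothesis k0 : (0 < k)%N.
Hypothesis XR : forall k (i j : 'I_N),
  ('E_P[fun w => (`|X i j w| ^+ k)%R] <= (Rk k)%:E)%E.

Lemma momentE : moment alpha X k N =
  N%:R^-1 * (Num.sqrt N%:R)^-1 ^+ k * \sum_(i : k.-tuple 'I_N) trace_term x0 (X (N := N)) alpha i.
Proof.
rewrite /moment -ExE -mulrA; congr (_ * _); rewrite mulr_sumr.
pose c := (Num.sqrt (N%:R : R))^-1.
pose F (i : k.-tuple 'I_N) w := (c ^+ k * \prod_(j < k) weight alpha (edge x0 i j)) *
  \prod_(j < k) X (edge x0 i j).1 (edge x0 i j).2 w.
have hX i j : all_moments P (X (N := N) i j) := entry_moments XR i j.
have hp (i : k.-tuple 'I_N) :
    all_moments P (fun w => \prod_(j < k) X (edge x0 i j).1 (edge x0 i j).2 w).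
  by apply: all_moments_prod => j; exact: hX.
rewrite (_ : (fun w => _) = fun w => \sum_(i : k.-tuple 'I_N) F i w).
  rewrite Ex_sum => [|i]; last by apply: all_momentsM => //; exact: all_moments_cst.
  by apply: eq_bigr => i _; rewrite ExZ // /trace_term /mixed_moment mulrA.
apply/funext => w; rewrite (trace_exp _ x0 k0).
apply: eq_bigr => i _; rewrite /F -mulrA -big_split /=.
rewrite -[in c ^+ k](card_ord k) -prodr_const -big_split /=.
by apply: eq_bigr => j _; rewrite mxE mulrA.
Qed.

End MomentExpansion.

(** * Size of the error *)

Section ErrorEstimate.
Variable R : realType.

Definition scale (k N : nat) : R := N%:R^-1 * (Num.sqrt N%:R)^-1 ^+ k.

Lemma scale_ge0 k N : 0 <= scale k N.
Proof. by rewrite mulr_ge0 ?invr_ge0 // exprn_ge0 // invr_ge0 sqrtr_ge0. Qed.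

Lemma scale_even k N : ~~ odd k -> scale k N = (N%:R ^+ (k./2).+1)^-1.
Proof.
move=> ek; rewrite /scale -{1}(even_halfK ek) -muln2 mulnC exprM exprVn sqr_sqrtr //.
by rewrite -exprS exprVn.
Qed.

(** The exponent is [-1 - k/2] plus [(k+1)/2] rounded down, hence at most [-1/2] for either
    parity. *)
Lemma scale_odd_power k N : (0 < N)%N ->
  scale k N * N%:R ^+ (k.+1)./2 <= (Num.sqrt N%:R)^-1.
Proof.
move=> N0; rewrite /scale; set q := Num.sqrt _.
have q2 : q ^+ 2 = N%:R by rewrite sqr_sqrtr.
have q1 : 1 <= q by rewrite -sqrtr1 ler_sqrt // ler1n.
have q0 : 0 < q by exact: lt_le_trans q1.
rewrite -q2 exprVn -invfM -exprM -exprD mulrC ler_pdivrMr ?exprn_gt0 //.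
rewrite ler_pdivlMl // -exprS ler_weXn2l //; lia.
Qed.

Variables (N : nat) (x0 : 'I_N) (r : rel ('I_N * 'I_N)) (B : nat) (k : nat).
Hypothesis r_equiv : equivalence_rel r.
Hypothesis r_flip : forall p q : 'I_N, r (p, q) (q, p).
Hypothesis rB : forall p q q' : 'I_N, (#|[set s | r (p, q) (q', s)]%SET| <= B)%N.
Hypothesis B0 : (0 < B)%N.
Hypothesis k0 : (0 < k)%N.

Let c1 := (\max_(p : 'I_N)
  #|[set t : 'I_N * 'I_N * 'I_N | r (p, t.1.1) (t.1.2, t.2)]%SET|)%N.
Let c3 := #|[set t : 'I_N * 'I_N * 'I_N |
  r (t.1.1, t.1.2) (t.1.2, t.2) && (t.2 != t.1.1)]%SET|.

(** As soon as a pairing exists, [k] is even and the scale is exactly [N^(-1-k/2)]; the bound on bad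
    tuples of order [(c1 + c3) * N^(k/2 - 1)] then leaves [(c1 + c3) / N^2]. *)
Lemma scaled_exceptions : scale k N * (exceptions x0 r k)%:R <=
  (k ^ k * B ^ k)%:R * (Num.sqrt N%:R)^-1 +
  (#|{ffun 'I_k -> 'I_k}| * (k * B ^ k))%:R * (c1%:R / (N ^ 2)%:R + c3%:R / (N ^ 2)%:R).
Proof.
have N0 : (0 < N)%N by case: (N) x0 => // -[].
have N0' : 0 < N%:R :> R by rewrite ltr0n.
rewrite /exceptions natrD mulrDr; apply: lerD.
  have few := card_few x0 r_equiv rB B0 k0.
  have {}few : (#|[set i : k.-tuple 'I_N | ((nclasses x0 r i).*2 < k)%N]%SET|%:R : R) <=
      (k ^ k * B ^ k)%:R * N%:R ^+ (k.+1)./2.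
    rewrite -natrX -natrM ler_nat (leq_trans few) // -mulnA [(B ^ k * _)%N]mulnC //.
  apply: (le_trans (ler_wpM2l (scale_ge0 k N) few)).
  by rewrite mulrCA ler_wpM2l // scale_odd_power.
set b := (k * B ^ k)%:R * (c1%:R / (N ^ 2)%:R + c3%:R / (N ^ 2)%:R) : R.
have b0 : 0 <= b by rewrite mulr_ge0 // addr_ge0 // divr_ge0.
rewrite natr_sum mulr_sumr natrM -mulrA -/b.
apply: (@le_trans _ _ (\sum_(p : {ffun 'I_k -> 'I_k}) b)); last first.
  by rewrite sumr_const mulr_natl.
rewrite big_mkcond; apply: ler_sum => p _; case: ifP => // pp.
have pP j : p j != j /\ p (p j) = j by have /forallP /(_ j) /andP [h /eqP] := pp.
have sP := pairing_ppseq pP.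
have ek : ~~ odd k by rewrite -(size_ppseq p); exact: pairing_even.
have k1 : (1 < k)%N by move: k0 ek; case: k => [|[|]].
have := card_bad_tuples x0 r_equiv r_flip rB B0 (size_ppseq p) sP k1.
move: #|bad_tuples _ _ _ _| => bd; rewrite -/c1 -/c3 => h.
have {}h : (bd%:R * N%:R : R) <= (k * B ^ k)%:R * (c1%:R + c3%:R) * N%:R ^+ k./2.
  by rewrite -natrM -natrD -natrX -!natrM ler_nat.
rewrite scale_even // mulrC ler_pdivrMr ?exprn_gt0 //.
rewrite -(ler_pM2r N0') (le_trans h) //.
rewrite /b natrX -mulrDl le_eqVlt; apply/orP; left; apply/eqP.
rewrite [_ ^+ (k./2).+1]exprS; move: (_ ^+ k./2) => z; field.
by rewrite gt_eqF.
Qed.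

End ErrorEstimate.

Theorem mainTheorem8 (R : realType) (d : measure_display) (T : measurableType d)
  (P : probability T R) (alpha : R -> R)
  (X : forall N : nat, 'I_N -> 'I_N -> {RV P >-> R})
  (eqv : forall N : nat, rel ('I_N * 'I_N)) :
  (* alpha bounded and Riemann-integrable on [0,1] *)
  (exists C : R, forall x : R, 0 <= x <= 1 -> `|alpha x| <= C) ->
  riemann_integrable01 alpha ->
  (* entries *)
  (forall N (i j : 'I_N) w, X N i j w = X N j i w) ->
  (forall N (i j : 'I_N), ('E_P[X N i j] = 0)%E) ->
  (forall N (i j : 'I_N), ('E_P[fun w => (X N i j w ^+ 2)%R] = 1)%E) ->
  (exists Rk : nat -> R, forall (k N : nat) (i j : 'I_N),
      ('E_P[fun w => (`|X N i j w| ^+ k)%R] <= (Rk k)%:E)%E) ->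
  (* the equivalence relations *)
  (forall N, equivalence_rel (eqv N)) ->
  (forall N (p q : 'I_N), eqv N (p, q) (q, p)) ->
  (* (C1) *)
  (fun N : nat => (\max_(p : 'I_N)
      #|[set t : 'I_N * 'I_N * 'I_N | eqv N (p, t.1.1) (t.1.2, t.2)]%SET|)%:R
      / (N ^ 2)%:R : R) @ \oo --> 0 ->
  (* (C2) *)
  (exists B : nat, forall N (p q r : 'I_N),
      (#|[set s : 'I_N | eqv N (p, q) (r, s)]%SET| <= B)%N) ->
  (* (C3) *)
  (fun N : nat => ((#|[set t : 'I_N * 'I_N * 'I_N |
      eqv N (t.1.1, t.1.2) (t.1.2, t.2) && (t.2 != t.1.1)]%SET|)%:R
      / (N ^ 2)%:R : R)) @ \oo --> 0 ->
  (* independence across equivalence classes *)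
  (forall N, indep_classes (X N) (eqv N)) ->
  forall k : nat, (0 < k)%N ->
    moment alpha X k @ \oo -->
      (if odd k then 0
       else \sum_(p : {ffun 'I_k -> 'I_k} | is_ncpp p) Jalpha alpha (ppseq p)).
Proof.
move=> [C0 aC0] aR Xsym X1 X2 [Rk XR] eqvE flip hC1 [B hB] hC3 indep k k0.
(* A pairing forces [k] to be even, so for odd [k] the sum is empty and the two cases of the limit
   merge. *)
have even_nc (p : {ffun 'I_k -> 'I_k}) : is_ncpp p -> ~~ odd k.
  by move=> /is_ncppP [/pairing_ppseq sP _]; rewrite -(size_ppseq p); exact: pairing_even.
have -> : (if odd k then 0 else \sum_(p : {ffun 'I_k -> 'I_k} | is_ncpp p) Jalpha alpha (ppseq p)) =
    \sum_(p : {ffun 'I_k -> 'I_k} | is_ncpp p) Jalpha alpha (ppseq p).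
  case: ifP => // ok; rewrite big_pred0 // => p; apply/negP => /even_nc.
  by rewrite ok.
(* With [C >= 1], a product over the blocks is bounded by the full power over all positions. *)
pose C := Num.max 1 C0.
have aC x : 0 <= x <= 1 -> `|alpha x| <= C.
  by move=> /aC0 h; rewrite le_max h orbT.
have C1 : 1 <= C by rewrite le_max lexx.
pose S N := \sum_(p : {ffun 'I_k -> 'I_k} | is_ncpp p)
  (N%:R ^+ (k./2).+1)^-1 * tree_sum alpha p N.
have cvgS : S @ \oo --> \sum_(p : {ffun 'I_k -> 'I_k} | is_ncpp p) Jalpha alpha (ppseq p).
  apply: cvg_big; first exact: add_continuous.
  by move=> p pnc; exact: (tree_sum_cvg pnc k0 aC aR).
pose c1 N : R := (\max_(p : 'I_N)
      #|[set t : 'I_N * 'I_N * 'I_N | eqv N (p, t.1.1) (t.1.2, t.2)]%SET|)%:R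
      / (N ^ 2)%:R.
pose c3 N : R := (#|[set t : 'I_N * 'I_N * 'I_N |
      eqv N (t.1.1, t.1.2) (t.1.2, t.2) && (t.2 != t.1.1)]%SET|)%:R
      / (N ^ 2)%:R.
pose err N : R := error_const Rk C k * ((k ^ k * B.+1 ^ k)%:R * (Num.sqrt N%:R)^-1 +
  (#|{ffun 'I_k -> 'I_k}| * (k * B.+1 ^ k))%:R * (c1 N + c3 N)).
have cvg_err : err @ \oo --> 0.
  rewrite -[X in _ --> X](mulr0 (error_const Rk C k)).
  apply: cvgMl_tmp; rewrite -[X in _ --> X](addr0 0); apply: cvgD.
    by rewrite -[X in _ --> X](mulr0 (k ^ k * B.+1 ^ k)%:R); apply: cvgMl_tmp; exact: cvg_inv_sqrt.
  rewrite -[X in _ --> X](mulr0 (#|{ffun 'I_k -> 'I_k}| * (k * B.+1 ^ k))%:R).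
  by apply: cvgMl_tmp; rewrite -[X in _ --> X](addr0 0); apply: cvgD.
have bound N : (0 < N)%N -> `|moment alpha X k N - S N| <= err N.
  move=> N0; pose x0 : 'I_N := Ordinal N0.
  (* [B.+1] is positive, as the counting bounds require, whatever the given constant. *)
  have hB' p q q' : (#|[set s : 'I_N | eqv N (p, q) (q', s)]%SET| <= B.+1)%N.
    exact: leq_trans (hB N p q q') (leqnSn B).
  have -> : S N = scale R k N * \sum_(p : {ffun 'I_k -> 'I_k} | is_ncpp p)
      \sum_(i : k.-tuple 'I_N | `[< folds x0 (ppseq p) i >]) tree_term x0 alpha p i.
    rewrite mulr_sumr; apply: eq_bigr => p pnc.
    by rewrite scale_even ?(even_nc p) // (tree_sumE alpha pnc k0 x0).
  rewrite (momentE (X := X) alpha x0 k0 (fun k i j => XR k N i j)) -mulrBr normrM.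
  rewrite (ger0_norm (scale_ge0 R k N)).
  have e1 := trace_terms_error x0 (@Xsym N) (@X1 N) (@X2 N) (fun k i j => XR k N i j)
    (eqvE N) (@flip N) (indep N) aC C1 k0.
  apply: (le_trans (ler_wpM2l (scale_ge0 R k N) e1)).
  rewrite mulrCA ler_wpM2l //; last exact: scaled_exceptions.
  exact: (error_const_ge0 x0 (fun k i j => XR k N i j)).
have cvg_diff : (fun N => moment alpha X k N - S N) @ \oo --> 0.
  apply: (@squeeze_cvgr _ _ _ _ (fun N => - err N) err); last exact: cvg_err.
    exists 1%N => // N /= N0; rewrite -ler_norml; exact: bound.
  by rewrite -oppr0; apply: cvgN.
have -> : moment alpha X k = (fun N => (moment alpha X k N - S N) + S N).
  by apply/funext => N; rewrite subrK.
by rewrite -[X in _ --> X]add0r; exact: cvgD cvg_diff cvgS.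
Qed.
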